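(* Consider the closed-loop switched stochastic system $$x(k+1)=A_{r(k)}x(k)+B_{r(k)}u(k),\qquad u(k)=K_{\sigma(k)}x(k),\qquad k\in\mathbb{N}_0,$$ with the setting described in the context. Suppose there exist a symmetric positive definite matrix $\tilde R\in\mathbb{R}^{n\times n}$, matrices $L_i\in\mathbb{R}^{m\times n}$, $i\in\mathcal{M}$, and scalars $\zeta_{i,j}\in(0,\infty)$, $i,j\in\mathcal{M}$, such that $$(A_i\tilde R+B_iL_j)^{\mathrm T}\tilde R^{-1}(A_i\tilde R+B_iL_j)-\zeta_{i,j}\tilde R\le 0\quad(\text{negative semidefinite}),\qquad i,j\in\mathcal{M},$$ and $$\sum_{\tau\in\mathbb{N}}\mu_\tau\sum_{l=1}^{\tau}\sum_{i,j\in\mathcal{M}}\pi_i\,p^{(l-1)}_{i,j}\ln\zeta_{j,i}<0 .$$ Then with feedback gains $K_i=L_i\tilde R^{-1}$, $i\in\mathcal{M}$, the zero solution $x(k)\equiv0$ of the closed-loop system is asymptotically stable almost surely.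
   Context: $\mathcal{M}=\{1,\dots,M\}$; $A_i\in\mathbb{R}^{n\times n}$, $B_i\in\mathbb{R}^{n\times m}$ are given. The mode signal $\{r(k)\in\mathcal{M}\}_{k\in\mathbb{N}_0}$ is an aperiodic irreducible discrete-time Markov chain with deterministic initial mode $r(0)=r_0$, transition probabilities $p_{i,j}$, $l$-step transition probabilities $p^{(l)}_{i,j}=\mathbb{P}[r(k+l)=j\mid r(k)=i]$ (entries of $P^l$, with $p^{(0)}_{i,j}=1$ if $i=j$ and $0$ otherwise), and invariant distribution $\pi$. The initial state $x(0)=x_0$ is deterministic. Mode observation instants $t_0=0<t_1<\dots$ are random with $\tau_i=t_i-t_{i-1}\in\mathbb{N}$, $i\in\mathbb{N}$, i.i.d. with distribution $\mathbb{P}[\tau_i=\tau]=\mu_\tau$ and $\hat\tau=\sum_\tau\tau\mu_\tau<\infty$; the counting process $N(k)=\sum_{i\in\mathbb{N}}\mathbb{1}[t_i\le k]$ is independent of $r$. The sampled mode is $\sigma(k)=r(t_{N(k)})$. The zero solution is almost surely stable if for all $\epsilon>0,\rho>0$ there is $\delta>0$ with $\|x(0)\|<\delta\Rightarrow \mathbb{P}[\sup_{k}\|x(k)\|>\epsilon]<\rho$; it is asymptotically stable almost surely if in addition $\mathbb{P}[\lim_{k\to\infty}\|x(k)\|=0]=1$. *)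

(* Defs.v *)
From HB Require Import structures.
From mathcomp Require Import all_boot all_order all_algebra.
From mathcomp Require Import all_classical all_reals all_analysis.
Set Implicit Arguments. Unset Strict Implicit. Unset Printing Implicit Defensive.
Import Order.TTheory GRing.Theory Num.Theory numFieldNormedType.Exports.
Local Open Scope ring_scope.
Local Open Scope classical_set_scope.

Section Defs.
Variable R : realType.

Definition vnorm n (v : 'cV[R]_n) : R := Num.sqrt (\sum_i (v i 0) ^+ 2).

Definition qform n (X : 'M[R]_n) (v : 'cV[R]_n) : R := ((v^T *m X *m v) 0 0).

Definition sym_posdef n (X : 'M[R]_n) : Prop :=
  X^T = X /\ forall v : 'cV[R]_n, v != 0 -> 0 < qform X v.

Definition neg_semidef n (X : 'M[R]_n) : Prop :=
  X^T = X /\ forall v : 'cV[R]_n, qform X v <= 0.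

Definition stochastic M (Pm : 'M[R]_M) : Prop :=
  (forall i j, 0 <= Pm i j) /\ (forall i, \sum_j Pm i j = 1).

Definition irreducible M (Pm : 'M[R]_M) : Prop :=
  forall i j : 'I_M, exists l : nat, 0 < (Pm ^+ l) i j.

Definition aperiodic M (Pm : 'M[R]_M) : Prop :=
  forall (i : 'I_M) (d : nat),
    (forall l : nat, (0 < l)%N -> 0 < (Pm ^+ l) i i -> (d %| l)%N) -> d = 1%N.

Definition invariant_distr M (Pm : 'M[R]_M) (pi : 'I_M -> R) : Prop :=
  (forall i, 0 <= pi i) /\ (\sum_i pi i = 1) /\
  (forall j, \sum_i pi i * Pm i j = pi j).

(* sampled-mode machinery: observation instants t_i = tau_1 + ... + tau_i,
   where tau_(i+1) is represented by [tau i]; counting process N(k) and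
   sampled mode sigma(k) = r(t_{N(k)}) *)
Definition obs_time (T : Type) (tau : nat -> T -> nat) (i : nat) (w : T) : nat :=
  (\sum_(j < i) tau j w)%N.

(* N(k) = #{ i >= 1 | t_i <= k }; since tau >= 1, t_i >= i, so i <= k suffices *)
Definition count_proc (T : Type) (tau : nat -> T -> nat) (k : nat) (w : T) : nat :=
  (\sum_(1 <= i < k.+1) (obs_time tau i w <= k))%N.

Definition sampled_mode (T : Type) M (r : nat -> T -> 'I_M) (tau : nat -> T -> nat)
  (k : nat) (w : T) : 'I_M :=
  r (obs_time tau (count_proc tau k w) w) w.

Fixpoint state (T : Type) n m M (A : 'I_M -> 'M[R]_n) (B : 'I_M -> 'M[R]_(n, m))
  (K : 'I_M -> 'M[R]_(m, n)) (r : nat -> T -> 'I_M) (sig : nat -> T -> 'I_M)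
  (x0 : 'cV[R]_n) (k : nat) (w : T) : 'cV[R]_n :=
  match k with
  | 0 => x0
  | k'.+1 => let x := state A B K r sig x0 k' w in
             A (r k' w) *m x + B (r k' w) *m (K (sig k' w) *m x)
  end.

Definition r_cyl (T : Type) M (r : nat -> T -> 'I_M) (k : nat) (s : nat -> 'I_M) : set T :=
  [set w | forall l, (l <= k)%N -> r l w = s l].

Definition tau_cyl (T : Type) (tau : nat -> T -> nat) (q : nat) (v : nat -> nat) : set T :=
  [set w | forall i, (i < q)%N -> tau i w = v i].

End Defs.

(* Main.v *)
Require Import Defs.
From HB Require Import structures.
From mathcomp Require Import all_boot all_order all_algebra.
From mathcomp Require Import all_classical all_reals all_analysis.
From mathcomp Require Import ring lra.
Import Order.TTheory GRing.Theory Num.Theory numFieldNormedType.Exports.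
Local Open Scope ring_scope.
Local Open Scope classical_set_scope.
Set Implicit Arguments. Unset Strict Implicit. Unset Printing Implicit Defensive.

(** Write [F a c = ln (zeta c a)] and [V x = x^T Rt^-1 x]. The matrix inequality
    gives [V (x_k) <= exp (S_k) V (x_0)], where [S_k] is the sum of the values
    [F (sigma l) (r l)], [l < k], so both claims follow from [S_k --> -oo] almost
    surely.

    The modes seen at the observation instants form a Markov chain with kernel
    [Q = \sum_t mu_t Pm^t], for which [pi] is invariant; since every power of
    [Pm] is irreducible, the kernel of [1 - Q] consists of the constants, and the
    Poisson equation for the mean block sums has a solution [h]. Adding [h] and a
    small drift to the block sums, truncated at block length [b], gives a
    supermartingale whose increments have square mean
    [O (1 + \sum_(t <= b) t^2 mu_t)]. A Kolmogorov maximal inequality for its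
    positive part is proved by backward induction over the history cylinders,
    using only the cylinder probabilities. With [D 2^n] blocks and [b = 2^n], the
    resulting bounds, as well as the probabilities that one of these blocks is
    longer than [b], are summable in [n] because [\sum_t t mu_t] is finite.
    Borel-Cantelli then bounds the sums at all observation instants by a negative
    multiple of the number of blocks, and makes the current block negligible. *)

(** * Quadratic forms *)

Section QuadraticForms.
Context {R : realType}.

Definition bform n (X : 'M[R]_n) (u v : 'cV[R]_n) : R := (u^T *m X *m v) 0 0.

Lemma bformDr n (X : 'M[R]_n) u v w :
  bform X u (v + w) = bform X u v + bform X u w.
Proof. by rewrite /bform mulmxDr mxE. Qed.

Lemma bformZr n (X : 'M[R]_n) u v a : bform X u (a *: v) = a * bform X u v.
Proof. by rewrite /bform -scalemxAr mxE. Qed.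

Lemma bformC n (X : 'M[R]_n) u v : X^T = X -> bform X u v = bform X v u.
Proof.
move=> symX; rewrite /bform -[in LHS]symX.
by rewrite -[v in LHS]trmxK -!trmx_mul mulmxA mxE.
Qed.

Lemma sym_posdef_qform_ge0 n (X : 'M[R]_n) v : sym_posdef X -> 0 <= qform X v.
Proof.
case=> _ posX; have [->|/posX/ltW//] := eqVneq v 0.
by rewrite /qform mulmx0 mxE.
Qed.

(** The form is nonnegative at the point of the line [u + t *: v] where it is smallest. *)
Lemma sym_posdef_cauchy_schwarz n (X : 'M[R]_n) u v :
  sym_posdef X -> bform X u v ^+ 2 <= qform X u * qform X v.
Proof.
move=> pdX; have [symX posX] := pdX.
have [->|v0] := eqVneq v 0.
  by rewrite /bform /qform !mulmx0 mxE expr0n mulr0.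
have qv := posX _ v0; set c := bform X u v.
pose t := - (c / qform X v).
have := sym_posdef_qform_ge0 (X := X) (u + t *: v) pdX.
have -> : qform X (u + t *: v) = qform X u + 2 * t * c + t ^+ 2 * qform X v.
  have qE w : qform X w = bform X w w by [].
  rewrite !qE bformDr bformZr (bformC _ u) // (bformC _ v) // !bformDr !bformZr.
  by rewrite (bformC v u) // -/c; ring.
move: (qform X u) => a; rewrite /t; move: (qform X v) qv => b b0 h.
have -> : c ^+ 2 = a * b - (a + 2 * - (c / b) * c + (- (c / b)) ^+ 2 * b) * b.
  by field; rewrite gt_eqF.
by rewrite gerBl mulr_ge0 // ltW.
Qed.

(** A nonzero row of the left kernel would be a nonzero vector at which the form vanishes. *)
Lemma sym_posdef_unitmx n (X : 'M[R]_n) : sym_posdef X -> X \in unitmx.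
Proof.
case=> symX posX; rewrite -row_free_unit -kermx_eq0; apply/eqP/row_matrixP => i.
rewrite row0; apply/eqP/negP => /negP ri0.
have : (row i (kermx X))^T != 0 by rewrite -trmx_eq0 trmxK.
move/posX; rewrite /qform trmxK.
have -> : row i (kermx X) *m X = 0 by apply/sub_kermxP; exact: row_sub.
by rewrite mul0mx mxE ltxx.
Qed.

Lemma sqr_vnorm n (v : 'cV[R]_n) : vnorm v ^+ 2 = \sum_i (v i 0) ^+ 2.
Proof. by rewrite sqr_sqrtr // sumr_ge0 // => i _; exact: sqr_ge0. Qed.

Lemma vnorm_ge0 n (v : 'cV[R]_n) : 0 <= vnorm v.
Proof. exact: sqrtr_ge0. Qed.

Lemma le_coord_vnorm n (v : 'cV[R]_n) i : `|v i 0| <= vnorm v.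
Proof.
rewrite -sqrtr_sqr; apply: ler_wsqrtr; rewrite (bigD1 i) //= lerDl.
by apply: sumr_ge0 => j _; exact: sqr_ge0.
Qed.

(** With [u = X^-1 v], the coordinate [v_i] is the form of [e_i] and [u], so Cauchy-Schwarz bounds
    its square by [X_ii] times the form at [u]. Summing over [i] gives the trace, and no eigenvalues
    are involved. *)
Lemma vnorm_qform_invmx n (X : 'M[R]_n) v : sym_posdef X ->
  vnorm v ^+ 2 <= \tr X * qform (invmx X) v.
Proof.
move=> pdX; have uX := sym_posdef_unitmx pdX; have [symX _] := pdX.
pose u := invmx X *m v; have vE : v = X *m u by rewrite mulKVmx.
have -> : qform (invmx X) v = qform X u.
  by rewrite vE /qform trmx_mul symX -!mulmxA mulKmx.
rewrite sqr_vnorm mulr_suml; apply: ler_sum => i _.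
have := sym_posdef_cauchy_schwarz (X := X) (delta_mx i 0) u pdX.
by rewrite /qform /bform trmx_delta -!mulmxA -vE -!rowE -colE !mxE.
Qed.

Lemma qform_le_vnorm n (X : 'M[R]_n) v :
  qform X v <= (\sum_i \sum_j `|X i j|) * vnorm v ^+ 2.
Proof.
rewrite /qform -mulmxA mxE mulr_suml; apply: ler_sum => i _.
rewrite !mxE mulr_sumr mulr_suml; apply: ler_sum => j _.
apply: le_trans (ler_norm _) _; rewrite !normrM mulrCA ler_wpM2l //.
by rewrite expr2 ler_pM ?le_coord_vnorm.
Qed.

(** The matrix inequality is evaluated at [y = X^-1 x]: there [G y] is the next state and the form
    of [X] at [y] equals that of [X^-1] at [x]. *)
Lemma lyapunov_step n m (X A : 'M[R]_n) (B : 'M[R]_(n, m)) (L : 'M[R]_(m, n))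
    z (x : 'cV[R]_n) : sym_posdef X ->
  neg_semidef ((A *m X + B *m L)^T *m invmx X *m (A *m X + B *m L) - z *: X) ->
  qform (invmx X) (A *m x + B *m (L *m invmx X *m x)) <= z * qform (invmx X) x.
Proof.
move=> pdX [_ /(_ (invmx X *m x))]; have uX := sym_posdef_unitmx pdX.
have [symX _] := pdX.
have symV : (invmx X)^T = invmx X by rewrite trmx_inv symX.
set G := A *m X + B *m L.
have GE : G *m (invmx X *m x) = A *m x + B *m (L *m invmx X *m x).
  by rewrite /G mulmxDl -!mulmxA mulKVmx.
rewrite /qform mulmxBr mulmxBl mxE -(scalemxAr) -scalemxAl.
by rewrite -GE !trmx_mul symV -!mulmxA mulKmx // !mxE subr_le0.
Qed.

End QuadraticForms.

(** * Powers of a stochastic matrix *)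

Section Stoch.
Context {R : realType} {M : nat}.
Implicit Types (Pm : 'M[R]_M).

Lemma stochastic_expr Pm l : stochastic Pm -> stochastic (Pm ^+ l).
Proof.
move=> [P0 P1]; elim: l => [|l [IH0 IH1]].
  split=> [i j|i]; first by rewrite expr0 mxE ler0n.
  by rewrite expr0 (bigD1 i) //= big1 ?addr0 ?mxE ?eqxx // => j /negPf ji;
    rewrite mxE eq_sym ji.
split=> [i j|i]; first by rewrite exprS mxE sumr_ge0 // => k _; rewrite mulr_ge0.
under eq_bigr do rewrite exprS mxE.
rewrite exchange_big /=.
by under eq_bigr do rewrite -mulr_sumr IH1 mulr1.
Qed.

Lemma expr_path_gt0 Pm k l a c b : stochastic Pm ->
  0 < (Pm ^+ k) a c -> 0 < (Pm ^+ l) c b -> 0 < (Pm ^+ (k + l)) a b.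
Proof.
move=> sP ac cb; rewrite exprD mxE (bigD1 c) //= ltr_pwDl ?mulr_gt0 //.
have [? _] := stochastic_expr k sP; have [? _] := stochastic_expr l sP.
by rewrite sumr_ge0 // => d _; rewrite mulr_ge0.
Qed.

Lemma expr_return_gt0 Pm k a n : stochastic Pm ->
  0 < (Pm ^+ k) a a -> 0 < (Pm ^+ (n * k)) a a.
Proof.
move=> sP aa; elim: n => [|n IH]; first by rewrite mul0n expr0 mxE eqxx.
by rewrite mulSn; exact: expr_path_gt0 IH.
Qed.

(* The residues mod [t] of the return times of [a] form a subgroup of Z/t, and
   its positive generator divides every return time. *)
Lemma aperiodic_return_mod Pm a t x : (0 < t)%N ->
  stochastic Pm -> aperiodic Pm ->
  exists2 l, 0 < (Pm ^+ l) a a & (l = x %[mod t])%N.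
Proof.
move=> t0 sP aP.
pose S x := exists2 l, 0 < (Pm ^+ l) a a & (l = x %[mod t])%N.
have SD y z : S y -> S z -> S (y + z)%N.
  move=> [k ka kE] [l la lE]; exists (k + l)%N; first exact: expr_path_gt0 la.
  by rewrite -modnDm kE lE modnDm.
have SM n y : S y -> S (n * y)%N.
  move=> [k ka kE]; exists (n * k)%N; first exact: expr_return_gt0.
  by rewrite -modnMmr kE modnMmr.
have SE y z : (y = z %[mod t])%N -> S y -> S z.
  by move=> yz [l la lE]; exists l => //; rewrite lE.
have St : S t by exists 0%N; rewrite ?expr0 ?mxE ?eqxx // mod0n modnn.
have exE : exists e, (0 < e)%N && `[< S e >] by exists t; rewrite t0; apply/asboolP.
case: (ex_minnP exE) => e /andP[e0 /asboolP Se] emin.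
have edvd y : S y -> (e %| y)%N.
  move=> Sy; rewrite /dvdn -leqn0 leqNgt; apply/negP => r0.
  have Sr : S (y %% e)%N.
    (* Modulo [t], subtracting [(y %/ e) * e] amounts to adding it [t.-1] times. *)
    apply: (SE (y + (t.-1 * (y %/ e)) * e)%N _ _ (SD _ _ Sy (SM _ _ Se))).
    rewrite {1}(divn_eq y e) addnAC -mulnDl -{1}[(y %/ e)%N]mul1n -mulnDl add1n prednK //.
    by rewrite -mulnA mulnC -modnDml modnMl add0n.
  have : (e <= y %% e)%N by apply: emin; rewrite r0; apply/asboolP.
  by rewrite leqNgt ltn_pmod.
have e1 : e = 1%N.
  by apply: (aP a) => l _ la; apply: edvd; exists l.
by have := SM x _ Se; rewrite e1 muln1.
Qed.

(** A path from [a] to [b] of length [p] is preceded by a return to [a] of length congruent to [-p]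
    modulo [t]; the total length is then a multiple of [t]. *)
Lemma primitive_expr Pm a b t : (0 < t)%N ->
  stochastic Pm -> irreducible Pm -> aperiodic Pm ->
  exists k, 0 < ((Pm ^+ t) ^+ k) a b.
Proof.
move=> t0 sP iP aP; have [p pab] := iP a b.
have [l laa lE] := aperiodic_return_mod a (t.-1 * p) t0 sP aP.
exists ((l + p) %/ t)%N; rewrite -exprM mulnC divnK; first exact: expr_path_gt0 pab.
by rewrite /dvdn -modnDml lE modnDml -mulSnr prednK // modnMr.
Qed.

(* Maximum principle: the set where [u] is maximal is closed under [Pm ^+ t]. *)
Lemma harmonic_const Pm (Q : 'M[R]_M) (u : 'cV[R]_M) t c : (0 < t)%N -> 0 < c ->
  stochastic Pm -> irreducible Pm -> aperiodic Pm -> stochastic Q ->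
  (forall a b, c * (Pm ^+ t) a b <= Q a b) ->
  Q *m u = u -> forall a b, u a 0 = u b 0.
Proof.
move=> t0 c0 sP iP aP [Q0 Q1] PQ Qu a0 b0.
have [am _ amax] := arg_maxP (fun a => u a 0) (erefl : xpredT a0).
suff um : forall b, u b 0 = u am 0 by rewrite !um.
have step a b : u a 0 = u am 0 -> 0 < (Pm ^+ t) a b -> u b 0 = u am 0.
  move=> ua ab; have Qab : 0 < Q a b by apply: lt_le_trans (PQ a b); rewrite mulr_gt0.
  have : \sum_d Q a d * (u am 0 - u d 0) = 0.
    under eq_bigr do rewrite mulrBr.
    rewrite big_split /= -mulr_suml Q1 mul1r sumrN.
    by have := congr1 (fun x : 'cV_M => x a 0) Qu; rewrite mxE => ->; rewrite ua subrr.
  move/eqP; rewrite psumr_eq0; last by move=> d _; rewrite mulr_ge0 // subr_ge0; exact: amax.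
  by move/allP/(_ b (mem_index_enum _)); rewrite mulf_eq0 (gt_eqF Qab) subr_eq0 /= eq_sym => /eqP.
move=> b; have [k] := primitive_expr am b t0 sP iP aP.
have [Pt0 _] := stochastic_expr t sP.
elim: k b => [|k IH] b.
  by rewrite expr0 mxE; case: eqVneq => [->//|]; rewrite ltxx.
rewrite exprSr mxE; case: (pselect (exists d, 0 < ((Pm ^+ t) ^+ k) am d /\
  0 < (Pm ^+ t) d b)) => [[d [kd db]] _|nod]; first exact: step (IH _ kd) db.
rewrite big1 ?ltxx // => d _; have [Pk0 _] := stochastic_expr k (stochastic_expr t sP).
have := Pk0 am d; rewrite le_eqVlt => /predU1P[<-|kd]; first by rewrite mul0r.
have := Pt0 d b; rewrite le_eqVlt => /predU1P[<-|db]; first by rewrite mulr0.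
by case: nod; exists d.
Qed.

End Stoch.

(** * Means with respect to the weights [mu] *)

Section MuMean.
Context {R : realType}.
Implicit Types (mu u v : nat -> R).

(** A relation, so that convergence of the series and the value of its limit travel together. *)
Definition has_mean mu u (l : R) : Prop :=
  series (fun t : nat => mu t * u t) @ \oo --> l.

Lemma has_mean_unique mu u l l' : has_mean mu u l -> has_mean mu u l' -> l = l'.
Proof. by move=> h h'; apply: (cvg_unique _ h h'). Qed.

Lemma has_meanD mu u v k l :
  has_mean mu u k -> has_mean mu v l -> has_mean mu (fun t => u t + v t) (k + l).
Proof.
move=> hu hv; rewrite /has_mean.
have -> : series (fun t => mu t * (u t + v t)) =
    series (fun t => mu t * u t) + series (fun t => mu t * v t).
  by rewrite -seriesD; congr series; apply/funext => t /=; rewrite mulrDr.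
exact: cvgD.
Qed.

Lemma has_meanZ mu u l c : has_mean mu u l -> has_mean mu (fun t => c * u t) (c * l).
Proof.
move=> hu; rewrite /has_mean.
have -> : series (fun t => mu t * (c * u t)) = (fun n => c * series (fun t => mu t * u t) n).
  by apply/funext => n; rewrite /series /= mulr_sumr; apply: eq_bigr => t _; rewrite mulrCA.
exact: cvgMl_tmp.
Qed.

Lemma has_mean_sum mu (I : Type) (s : seq I) (u : I -> nat -> R) (l : I -> R) :
  (forall i, has_mean mu (u i) (l i)) ->
  has_mean mu (fun t => \sum_(i <- s) u i t) (\sum_(i <- s) l i).
Proof.
move=> h; elim: s => [|i s IH].
  rewrite big_nil; apply: cvg_near_cst; apply: nearW => n.
  by rewrite /series /= big1 // => t _; rewrite big_nil mulr0.
rewrite big_cons; have := has_meanD (h i) IH; congr (has_mean _ _ _).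
by apply/funext => t; rewrite big_cons.
Qed.

Lemma has_mean_le mu u v k l : (forall t, 0 <= mu t) -> (forall t, u t <= v t) ->
  has_mean mu u k -> has_mean mu v l -> k <= l.
Proof.
move=> mu0 uv hu hv; apply: (ler_cvg_to hu hv); apply: nearW => n.
by apply: ler_sum => t _; rewrite ler_wpM2l.
Qed.

Lemma has_mean_cst mu c : series mu @ \oo --> (1 : R) -> has_mean mu (fun=> c) c.
Proof.
move=> h; have : has_mean mu (fun=> 1) 1.
  by rewrite /has_mean; under eq_fun do rewrite mulr1.
by move/(has_meanZ (c := c)); rewrite mulr1.
Qed.

(** The index is [b.+1] because [series] at [n] sums the terms of index below [n]. *)
Lemma has_mean_finite mu u b :
  has_mean mu (fun t => if (t <= b)%N then u t else 0) (series (fun t => mu t * u t) b.+1).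
Proof.
apply: cvg_near_cst; near=> n.
have bn : (b.+1 <= n)%N by near: n; exists b.+1.
rewrite /series /= (big_cat_nat _ bn) //=.
rewrite [X in _ + X]big_nat_cond [X in _ + X]big1 ?addr0; last first.
  by move=> t /andP[/andP[bt _] _]; rewrite leqNgt bt mulr0.
by rewrite big_nat_cond [in RHS]big_nat_cond; apply: eq_bigr => t /andP[/andP[_ tb] _]; rewrite -ltnS tb.
Unshelve. all: by end_near. Qed.

(** Comparison with [C * (mu t + t * mu t)] gives absolute convergence; sums over a block of length
    [t] grow at most linearly, as required here. *)
Lemma has_mean_dominated mu u C : (forall t, 0 <= mu t) ->
  series mu @ \oo --> (1 : R) -> cvg (series (fun t : nat => t%:R * mu t) @ \oo) ->
  (forall t, `|u t| <= C * (1 + t%:R)) -> exists l, has_mean mu u l.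
Proof.
move=> mu0 mu1 mut uC; apply/cvg_ex; apply: normed_cvg.
have C0 : 0 <= C by have := le_trans (normr_ge0 _) (uC 0%N); rewrite addr0 mulr1.
apply: (series_le_cvg (v_ := fun t => C * (mu t + t%:R * mu t))) => [t|t|t|].
- exact: normr_ge0.
- by rewrite mulr_ge0 // addr_ge0 // mulr_ge0.
- rewrite /= normrM (ger0_norm (mu0 t)) -[X in _ + X]mulrC -[X in X + _]mulr1.
  by rewrite -mulrDr mulrCA ler_wpM2l.
- have /cvg_ex[l tl] := mut; apply/cvg_ex; exists (C * (1 + l)).
  have -> : series (fun t => C * (mu t + t%:R * mu t)) =
      (fun n => C * (series mu n + series (fun t => t%:R * mu t) n)).
    by apply/funext => n; rewrite /series /= -big_split mulr_sumr.
  by apply: cvgMl_tmp; exact: cvgD.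
Qed.

End MuMean.

(** * The Poisson equation *)

Section Poisson.
Context {R : realType} {M : nat}.
Implicit Types (Pm : 'M[R]_M) (mu : nat -> R).

Lemma mass_one_has_atom mu : (forall t, 0 <= mu t) -> mu 0%N = 0 ->
  series mu @ \oo --> (1 : R) -> exists2 t, (0 < t)%N & 0 < mu t.
Proof.
move=> mu0 mu00 mu1; apply: contrapT => nex.
have mz t : mu t = 0.
  case: t => [//|t]; apply/eqP; rewrite eq_le mu0 andbT leNgt; apply/negP => mt.
  by apply: nex; exists t.+1.
have : series mu @ \oo --> (0 : R).
  by apply: cvg_near_cst; apply: nearW => n; rewrite /series /= big1.
move=> h; have e : 1 = 0 :> R := cvg_unique (@Rhausdorff R) mu1 h.
by have := oner_neq0 R; rewrite e eqxx.
Qed.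

(** Fredholm alternative: the kernel of [1 - Q] is at most one-dimensional, so its range fills the
    whole annihilator of [pi]. The centred mean [g - s] lies there, and [h] is a preimage of it. *)
Lemma poisson_equation Pm (pi : 'I_M -> R) mu (G : nat -> 'I_M -> R) C s :
  stochastic Pm -> irreducible Pm -> aperiodic Pm -> invariant_distr Pm pi ->
  (forall t, 0 <= mu t) -> mu 0%N = 0 -> series mu @ \oo --> (1 : R) ->
  cvg (series (fun t : nat => t%:R * mu t) @ \oo) ->
  (forall t a, `|G t a| <= C * (1 + t%:R)) ->
  has_mean mu (fun t => \sum_a pi a * G t a) s ->
  exists h : 'I_M -> R, forall a,
    has_mean mu (fun t => \sum_b (Pm ^+ t) a b * h b + G t a) (h a + s).
Proof.
move=> sP iP aP [pi0 [pi1 piP]] mu0 mu00 mu1 mut GC Gs.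
have gex a : exists l, has_mean mu (G^~ a) l.
  by apply: (has_mean_dominated (C := C)) => // t; exact: GC.
have [g gE] := choice gex.
have Pt_le1 t a b : (Pm ^+ t) a b <= 1.
  have [Pt0 Pt1] := stochastic_expr t sP.
  by rewrite -(Pt1 a) (bigD1 b) //= lerDl sumr_ge0.
have qex (ab : 'I_M * 'I_M) : exists l, has_mean mu (fun t => (Pm ^+ t) ab.1 ab.2) l.
  apply: (has_mean_dominated (C := 1)) => // t; have [Pt0 _] := stochastic_expr t sP.
  by rewrite ger0_norm // mul1r (le_trans (Pt_le1 _ _ _)) // lerDl.
have [q qE] := choice qex; pose Q : 'M[R]_M := \matrix_(a, b) q (a, b).
have QE a b : has_mean mu (fun t => (Pm ^+ t) a b) (Q a b) by rewrite mxE; exact: (qE (a, b)).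
have piPt t b : \sum_a pi a * (Pm ^+ t) a b = pi b.
  elim: t b => [|t IH] b.
    rewrite expr0 (bigD1 b) //= big1 ?addr0 ?mxE ?eqxx ?mulr1 // => a /negPf ab.
    by rewrite mxE ab mulr0.
  under eq_bigr do rewrite exprSr mxE mulr_sumr.
  rewrite exchange_big /=; under eq_bigr do under eq_bigr do rewrite mulrA.
  by under eq_bigr do rewrite -mulr_suml IH; exact: piP.
have sQ : stochastic Q.
  split=> [a b|a].
    apply: (has_mean_le mu0 _ (has_mean_cst (c := 0) mu1) (QE a b)) => t.
    by have [Pt0 _] := stochastic_expr t sP.
  apply: (has_mean_unique (has_mean_sum (s := index_enum 'I_M) (QE a))).
  have := has_mean_cst (c := 1) mu1; congr (has_mean _ _ _); apply/funext => t.
  by have [_ ->] := stochastic_expr t sP.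
have piQ b : \sum_a pi a * Q a b = pi b.
  apply: (has_mean_unique (has_mean_sum (s := index_enum 'I_M)
    (fun a => has_meanZ (c := pi a) (QE a b)))).
  have := has_mean_cst (c := pi b) mu1; congr (has_mean _ _ _); apply/funext => t.
  by rewrite piPt.
have [t0 t0_gt0 mut0] := mass_one_has_atom mu0 mu00 mu1.
(* Since [Q] dominates a positive multiple of a single power of [Pm], the maximum principle applies
   to its harmonic vectors. *)
have PQ a b : mu t0 * (Pm ^+ t0) a b <= Q a b.
  have [Pt0 _] := stochastic_expr t0 sP.
  apply: (ler_cvg_to (cvg_cst (mu t0 * (Pm ^+ t0) a b)) (QE a b)).
  exists t0.+1 => // n /= t0n; rewrite /series /= (bigD1_seq t0) ?iota_uniq //=.
    by rewrite lerDl sumr_ge0 // => t _; have [? _] := stochastic_expr t sP; rewrite mulr_ge0.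
  by rewrite mem_index_iota.
(* The transpose turns solvability of the equation into membership in a row space. *)
pose B := (1%:M - Q)^T; pose pic : 'cV[R]_M := \col_a pi a.
have Bpic : B *m pic = 0.
  apply/matrixP => a z; rewrite !mxE.
  under eq_bigr do rewrite !mxE mulrBl.
  rewrite big_split /= sumrN (bigD1 a) //= big1 ?addr0; last first.
    by move=> b /negPf ba; rewrite ba mul0r.
  rewrite eqxx mul1r -[X in X - _]piQ -sumrB big1 // => b _.
  by rewrite mxE mulrC subrr.
have pic0 : pic != 0.
  apply/eqP => p0; have := pi1; rewrite big1; first by move/esym/eqP; rewrite oner_eq0.
  by move=> a _; have := congr1 (fun x : 'cV_M => x a 0) p0; rewrite !mxE.
have kerB : (\rank (kermx B) <= 1)%N.
  apply: leq_trans (mxrankS (_ : (kermx B <= (const_mx 1 : 'rV[R]_M))%MS)) (rank_leq_row _).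
  apply/row_subP => i; set u := row i (kermx B).
  have uB : u *m B = 0 by apply/sub_kermxP; exact: row_sub.
  have Qu : Q *m u^T = u^T.
    move: uB; rewrite /B => /(congr1 trmx); rewrite trmx_mul trmxK trmx0 mulmxBl mul1mx.
    by move/eqP; rewrite subr_eq0 => /eqP.
  have uc := harmonic_const t0_gt0 mut0 sP iP aP sQ PQ Qu.
  have -> : u = u 0 i *: const_mx 1.
    apply/rowP => j; have := uc j i; rewrite [u^T j 0]mxE [u^T i 0]mxE => ->.
    by rewrite [RHS]mxE [const_mx _ _ _]mxE mulr1.
  exact: scalemx_sub.
have BK : (B <= kermx pic)%MS by apply/sub_kermxP.
(* Equality by dimension: [kermx pic] has rank [M - 1] as [pic] is nonzero, and [B] has rank at
   least [M - 1]. *)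
have KB : (kermx pic <= B)%MS.
  rewrite -(geq_leqif (mxrank_leqif_sup BK)) mxrank_ker.
  move: kerB; rewrite mxrank_ker => kerB.
  by rewrite leq_subLR addnC -leq_subLR (leq_trans kerB) // lt0n mxrank_eq0.
pose y : 'rV[R]_M := \row_a (g a - s).
have gs : \sum_a pi a * g a = s.
  exact: (has_mean_unique (has_mean_sum (s := index_enum 'I_M)
    (fun a => has_meanZ (c := pi a) (gE a))) Gs).
have : (y <= B)%MS.
  apply: submx_trans KB; apply/sub_kermxP/matrixP => i j; rewrite !mxE.
  under eq_bigr do rewrite !mxE mulrBl mulrC.
  by rewrite big_split /= sumrN -mulr_sumr pi1 mulr1 gs subrr.
case/submxP => D yE; exists (fun a => D 0 a) => a.
have hE : \sum_b D 0 b * Q a b + g a = D 0 a + s.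
  have := congr1 (fun x : 'rV_M => x 0 a) yE; rewrite !mxE.
  under eq_bigr do rewrite !mxE mulrBr.
  rewrite big_split /= sumrN (bigD1 a) //= big1 ?addr0; last first.
    by move=> b /negPf ba; rewrite eq_sym ba mulr0.
  rewrite eqxx mulr1 => e.
  have -> : \sum_b D 0 b * Q a b = \sum_b D 0 b * q (a, b).
    by apply: eq_bigr => b _; rewrite mxE.
  by move: e; set S := \sum_b _ => e; lra.
rewrite -hE; apply: has_meanD (gE a).
have := has_mean_sum (s := index_enum 'I_M) (fun b => has_meanZ (c := D 0 b) (QE a b)).
by congr (has_mean _ _ _); apply/funext => t; apply: eq_bigr => b _; rewrite mulrC.
Qed.

End Poisson.

(** * Discrete measurability and block sums *)

Section DiscreteMeasurability.
Context {d : measure_display} {T : measurableType d}.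

(* Measurability for the discrete sigma-algebra on the codomain. *)
Definition dmeas (X : Type) (Phi : T -> X) : Prop :=
  forall A : set X, measurable (Phi @^-1` A).

Lemma dmeas_comp X Y (g : X -> Y) (Phi : T -> X) :
  dmeas Phi -> dmeas (fun w => g (Phi w)).
Proof. by move=> mPhi A; exact: (mPhi (g @^-1` A)). Qed.

Lemma measurable_bigcup_count (I : countType) (F : I -> set T) :
  (forall i, measurable (F i)) -> measurable [set w | exists i, F i w].
Proof.
move=> mF.
have -> : [set w | exists i, F i w] =
    \bigcup_n (if unpickle n is Some i then F i else set0).
  apply/seteqP; split=> w [] => [i Fi|n _].
    by exists (pickle i) => //; rewrite pickleK.
  by case: (unpickle n) => // i Fi; exists i.
by apply: bigcupT_measurable => n; case: (unpickle n).
Qed.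

(** Splitting over the countably many values of [Phi] freezes one random index or mode at a time.
    Real-valued scores are discretely measurable because they are built in this way. *)
Lemma dmeas_bind (I : countType) X (Phi : T -> I) (Psi : I -> T -> X) :
  (forall i, measurable [set w | Phi w = i]) -> (forall i, dmeas (Psi i)) ->
  dmeas (fun w => Psi (Phi w) w).
Proof.
move=> mPhi mPsi A.
have -> : (fun w => Psi (Phi w) w) @^-1` A =
    [set w | exists i, ([set w | Phi w = i] `&` Psi i @^-1` A) w].
  apply/seteqP; split=> w /=; first by exists (Phi w).
  by case=> i [<-].
by apply: measurable_bigcup_count => i; apply: measurableI => //; exact: mPsi.
Qed.

Lemma dmeas_cst X (x : X) : dmeas (fun=> x).
Proof.
move=> A; have [Ax|nAx] := pselect (A x).
  by rewrite [X in measurable X](_ : _ = setT) //; apply/seteqP; split.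
by rewrite [X in measurable X](_ : _ = set0) //; apply/seteqP; split.
Qed.

Lemma dmeas_fiber (I : countType) (Phi : T -> I) :
  (forall i, measurable [set w | Phi w = i]) -> dmeas Phi.
Proof. by move=> mPhi; apply: (dmeas_bind mPhi (fun i => dmeas_cst i)). Qed.

End DiscreteMeasurability.

Section Scores.
Context {R : realType} {M : nat}.
Implicit Types (F : 'I_M -> 'I_M -> R) (v : nat -> nat) (s : nat -> 'I_M).

(** The observation instant of a fixed gap sequence; [obs_time tau q w] is convertible to
    [tsum (tau^~ w) q]. *)
Definition tsum v (q : nat) : nat := (\sum_(i < q) v i)%N.

Lemma tsum0 v : tsum v 0 = 0%N. Proof. by rewrite /tsum big_ord0. Qed.

Lemma tsumS v q : tsum v q.+1 = (tsum v q + v q)%N.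
Proof. by rewrite /tsum big_ord_recr. Qed.

Lemma leq_tsum v p q : (p <= q)%N -> (tsum v p <= tsum v q)%N.
Proof.
move=> /subnK <-; elim: (q - p)%N => [//|k IH].
by rewrite addSn tsumS (leq_trans IH) // leq_addr.
Qed.

Lemma tsum_ext v v' q : (forall i, (i < q)%N -> v i = v' i) -> tsum v q = tsum v' q.
Proof. by move=> vv; apply: eq_bigr => i _; exact: vv. Qed.

(** The logarithmic gain over [j] steps from an observation at time [k]: the first argument stays at
    the mode observed there. *)
Definition blk F s (k j : nat) : R := \sum_(l < j) F (s k) (s (k + l)%N).

Lemma blk_ext F s s' k j : (forall l, (l <= k + j)%N -> s l = s' l) ->
  blk F s k j = blk F s' k j.
Proof.
move=> ss; apply: eq_bigr => l _; rewrite !ss ?leq_addr //.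
by rewrite leq_add2l ltnW.
Qed.

Lemma blkS F s k j : blk F s k j.+1 = blk F s k j + F (s k) (s (k + j)%N).
Proof. by rewrite /blk big_ord_recr. Qed.

Lemma norm_blk_le F s k j C : (forall a c, `|F a c| <= C) ->
  `|blk F s k j| <= C * j%:R.
Proof.
move=> FC; apply: le_trans (ler_norm_sum _ _ _) _.
apply: (@le_trans _ _ (\sum_(l < j) C)); first exact: ler_sum.
by rewrite sumr_const card_ord mulr_natr.
Qed.

(** A block longer than [b] is discarded as a whole instead of being cut at [b]. *)
Definition trunc (b t : nat) F : 'I_M -> 'I_M -> R :=
  fun a c => if (t <= b)%N then F a c else 0.

Definition bscore b F v s q : R :=
  \sum_(i < q) blk (trunc b (v i) F) s (tsum v i) (v i).

(** The Poisson corrector [h] telescopes over the blocks and replaces the mode-dependent mean of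
    each block by a uniform one; [eta] per block is the part of the negative drift given back. *)
Definition ascore b F (h : 'I_M -> R) eta v s q : R :=
  bscore b F v s q + h (s (tsum v q)) - h (s 0%N) + eta * q%:R.

Lemma bscore_ext b F v v' s s' q : (forall i, (i < q)%N -> v i = v' i) ->
  (forall l, (l <= tsum v q)%N -> s l = s' l) ->
  bscore b F v s q = bscore b F v' s' q.
Proof.
move=> vv ss; apply: eq_bigr => i _.
have ti : tsum v i = tsum v' i.
  by apply: tsum_ext => j ji; apply: vv; exact: ltn_trans ji _.
rewrite -(vv i) // -ti; apply: blk_ext => l lt; apply: ss.
by rewrite (leq_trans lt) // -tsumS leq_tsum.
Qed.

Lemma ascore_ext b F h eta v v' s s' q : (forall i, (i < q)%N -> v i = v' i) ->
  (forall l, (l <= tsum v q)%N -> s l = s' l) ->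
  ascore b F h eta v s q = ascore b F h eta v' s' q.
Proof.
move=> vv ss; rewrite /ascore (bscore_ext b F vv ss) -(tsum_ext vv).
by rewrite !ss.
Qed.

Lemma ascoreS b F h eta v s q : ascore b F h eta v s q.+1 =
  ascore b F h eta v s q + (blk (trunc b (v q) F) s (tsum v q) (v q)
    + h (s (tsum v q + v q)%N) - h (s (tsum v q)) + eta).
Proof.
by rewrite /ascore /bscore big_ord_recr /= tsumS -[in LHS]natr1; ring.
Qed.

(* Expected block sum plus terminal value of [h], started from [c], when the
   block was opened in mode [a] and [j] steps remain. *)
Definition lin (Pm : 'M[R]_M) F h (a : 'I_M) j (c : 'I_M) : R :=
  \sum_e (Pm ^+ j) c e * h e + \sum_(l < j) \sum_e (Pm ^+ l) c e * F a e.

Lemma sum_expr0 (Pm : 'M[R]_M) (u : 'I_M -> R) c :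
  \sum_e (Pm ^+ 0) c e * u e = u c.
Proof.
rewrite expr0 (bigD1 c) //= big1 ?addr0 ?mxE ?eqxx ?mul1r //.
by move=> e /negPf ec; rewrite mxE eq_sym ec mul0r.
Qed.

Lemma lin0 Pm F h a c : lin Pm F h a 0 c = h c.
Proof. by rewrite /lin big_ord0 addr0 sum_expr0. Qed.

Lemma linS Pm F h a j c :
  lin Pm F h a j.+1 c = F a c + \sum_e Pm c e * lin Pm F h a j e.
Proof.
have PS (l : nat) (u : 'I_M -> R) : \sum_e (Pm ^+ l.+1) c e * u e =
    \sum_e Pm c e * (\sum_e' (Pm ^+ l) e e' * u e').
  under eq_bigr do rewrite exprS mxE mulr_suml.
  rewrite exchange_big /=; apply: eq_bigr => e _; rewrite mulr_sumr.
  by apply: eq_bigr => e' _; rewrite mulrA.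
rewrite /lin PS big_ord_recl sum_expr0 addrCA; congr (_ + _).
under [in RHS]eq_bigr do rewrite mulrDr.
rewrite big_split /=; congr (_ + _).
under eq_bigr do rewrite PS.
by rewrite exchange_big /=; apply: eq_bigr => e _; rewrite mulr_sumr.
Qed.

End Scores.

(** * The maximal inequality *)

Section RealProbability.
Context {R : realType} {d : measure_display} {T : measurableType d}.
Variable P : probability T R.

Definition pr (A : set T) : R := fine (P A).

Lemma prE A : measurable A -> P A = (pr A)%:E.
Proof. by move=> mA; rewrite /pr fineK // fin_num_measure. Qed.

Lemma pr_ge0 A : 0 <= pr A. Proof. by rewrite /pr fine_ge0. Qed.

Lemma le_pr A B : measurable A -> measurable B -> A `<=` B -> pr A <= pr B.
Proof.
by move=> mA mB AB; rewrite -lee_fin -!prE // le_measure // inE.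
Qed.

Lemma prU_le A B : measurable A -> measurable B -> pr (A `|` B) <= pr A + pr B.
Proof.
move=> mA mB; rewrite -lee_fin EFinD -!prE //; last exact: measurableU.
exact: measureU2.
Qed.

Lemma pr_partition_nat (Phi : T -> nat) A : measurable A ->
  (forall t, measurable [set w | Phi w = t]) ->
  series (fun t => pr (A `&` [set w | Phi w = t])) @ \oo --> pr A.
Proof.
move=> mA mPhi; pose F t := A `&` [set w | Phi w = t].
have mF t : measurable (F t) by exact: measurableI.
have FA : \bigcup_t F t = A.
  by apply/seteqP; split=> [w [t _ []]//|w Aw]; exists (Phi w).
have tF : trivIset setT F.
  by apply/trivIsetP => i j _ _ /eqP ij; apply/seteqP; split=> // w [[_ /= wi] [_ /= wj]];
    apply: ij; rewrite -wi -wj.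
have : (fun n => \sum_(0 <= i < n) P (F i))%E @ \oo --> P A.
  by rewrite -FA; apply: measure_semi_sigma_additive => //; rewrite FA.
rewrite (prE mA) => /fine_cvg; rewrite (_ : fine \o _ = series (fun t => pr (F t))) //.
apply/funext => n /=; rewrite /series /=.
by under eq_bigr do rewrite prE //; rewrite sumEFin.
Qed.

Lemma pr_partition_ord M (Phi : T -> 'I_M) A : measurable A ->
  (forall j, measurable [set w | Phi w = j]) ->
  \sum_j pr (A `&` [set w | Phi w = j]) = pr A.
Proof.
move=> mA mPhi; pose F j := A `&` [set w | Phi w = j].
have mF j : measurable (F j) by exact: measurableI.
have tF : trivIset setT F.
  by apply/trivIsetP => i j _ _ /eqP ij; apply/seteqP; split=> // w [[_ /= wi] [_ /= wj]];
    apply: ij; rewrite -wi -wj.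
apply: EFin_inj; rewrite -sumEFin -prE //.
have AE : A = \big[setU/set0]_(j < M) F j.
  rewrite -bigcup_seq; apply/seteqP; split=> [w Aw|w [j _ []]//].
  by exists (Phi w) => //=; rewrite mem_index_enum.
by rewrite [in RHS]AE measure_bigsetU_ord //; apply: eq_bigr => j _; exact/esym/prE.
Qed.

End RealProbability.

Definition upd (X : Type) (v : nat -> X) (q : nat) (x : X) : nat -> X :=
  fun i => if i == q then x else v i.

Lemma upd_same X (v : nat -> X) q x : upd v q x q = x.
Proof. by rewrite /upd eqxx. Qed.

Lemma upd_lt X (v : nat -> X) q x i : (i < q)%N -> upd v q x i = v i.
Proof. by rewrite /upd; case: eqVneq => // ->; rewrite ltnn. Qed.

(** * Cylinder events of gap and mode histories *)

Section Process.
Context {R : realType} {d : measure_display} {T : measurableType d}.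
Variables (P : probability T R) (M : nat) (Pm : 'M[R]_M).
Variables (r : nat -> T -> 'I_M) (mu : nat -> R) (tau : nat -> T -> nat).
Hypothesis mr : forall k i, measurable [set w | r k w = i].
Hypothesis rP : forall (k : nat) (s : nat -> 'I_M) (j : 'I_M),
  P (r_cyl r k s `&` [set w | r k.+1 w = j]) = (P (r_cyl r k s) * (Pm (s k) j)%:E)%E.
Hypothesis r_init : forall w w', r 0%N w = r 0%N w'.
Hypothesis mtau : forall i k, measurable [set w | tau i w = k].
Hypothesis tauP : forall (q : nat) (v : nat -> nat),
  P (tau_cyl tau q v) = (\prod_(i < q) mu (v i))%:E.
Hypothesis indep : forall (k : nat) (s : nat -> 'I_M) (q : nat) (v : nat -> nat),
  P (r_cyl r k s `&` tau_cyl tau q v) = (P (r_cyl r k s) * P (tau_cyl tau q v))%E.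
Local Notation pr := (pr P).
Implicit Types (F : 'I_M -> 'I_M -> R) (h : 'I_M -> R) (eta x : R).

Lemma measurable_r_cyl k s : measurable (r_cyl r k s).
Proof.
have -> : r_cyl r k s =
    \bigcap_l (if (l <= k)%N then [set w | r l w = s l] else setT).
  apply/seteqP; split=> w h l; first by move=> _; case: ifP => // /h.
  by move=> lk; have := h l I; rewrite lk.
by apply: bigcapT_measurable => l; case: ifP.
Qed.

Lemma measurable_tau_cyl q v : measurable (tau_cyl tau q v).
Proof.
have -> : tau_cyl tau q v =
    \bigcap_i (if (i < q)%N then [set w | tau i w = v i] else setT).
  apply/seteqP; split=> w h l; first by move=> _; case: ifP => // /h.
  by move=> lk; have := h l I; rewrite lk.
by apply: bigcapT_measurable => l; case: ifP.
Qed.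

Definition cyl q v k s : set T := tau_cyl tau q v `&` r_cyl r k s.

Lemma measurable_cyl q v k s : measurable (cyl q v k s).
Proof. by apply: measurableI; [exact: measurable_tau_cyl|exact: measurable_r_cyl]. Qed.

Lemma r_cylS k s j :
  r_cyl r k.+1 (upd s k.+1 j) = r_cyl r k s `&` [set w | r k.+1 w = j].
Proof.
apply/seteqP; split=> w.
  move=> h; split=> [l lk|]; last by rewrite /= (h k.+1 (leqnn _)) upd_same.
  by rewrite (h l (leqW lk)) upd_lt.
case=> h hj l; rewrite leq_eqVlt => /predU1P[->|lk]; first by rewrite upd_same.
by rewrite upd_lt //; exact: h.
Qed.

Lemma tau_cylS q v t :
  tau_cyl tau q.+1 (upd v q t) = tau_cyl tau q v `&` [set w | tau q w = t].
Proof.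
apply/seteqP; split=> w.
  move=> h; split=> [i iq|]; last by rewrite /= (h q (leqnn _)) upd_same.
  by rewrite (h i (leqW iq)) upd_lt.
case=> h ht i; rewrite ltnS leq_eqVlt => /predU1P[->|iq]; first by rewrite upd_same.
by rewrite upd_lt //; exact: h.
Qed.

Lemma cyl_tauS q v k s t :
  cyl q.+1 (upd v q t) k s = cyl q v k s `&` [set w | tau q w = t].
Proof. by rewrite /cyl tau_cylS setIAC. Qed.

Lemma cyl_rS q v k s j :
  cyl q v k.+1 (upd s k.+1 j) = cyl q v k s `&` [set w | r k.+1 w = j].
Proof. by rewrite /cyl r_cylS setIA. Qed.

(** The root of the backward inductions: the deterministic initial mode makes the empty history the
    sure event. *)
Lemma cyl0 v w0 : cyl 0 v 0 (fun=> r 0 w0) = setT.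
Proof.
apply/seteqP; split=> // w _; split=> // l.
by rewrite leqn0 => /eqP ->; exact: r_init.
Qed.

Lemma pr_cyl q v k s :
  pr (cyl q v k s) = (\prod_(i < q) mu (v i)) * pr (r_cyl r k s).
Proof.
apply: EFin_inj; rewrite -prE; last exact: measurable_cyl.
rewrite /cyl setIC indep tauP prE; last exact: measurable_r_cyl.
by rewrite -EFinM mulrC.
Qed.

Lemma pr_cyl_tauS q v k s t :
  pr (cyl q.+1 (upd v q t) k s) = pr (cyl q v k s) * mu t.
Proof.
rewrite !pr_cyl big_ord_recr /= upd_same mulrAC; congr (_ * _ * _).
by apply: eq_bigr => i _; rewrite upd_lt.
Qed.

Lemma pr_cyl_rS q v k s j :
  pr (cyl q v k.+1 (upd s k.+1 j)) = pr (cyl q v k s) * Pm (s k) j.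
Proof.
rewrite !pr_cyl -mulrA; congr (_ * _); apply: EFin_inj.
rewrite EFinM -!prE; [|exact: measurable_r_cyl..].
by rewrite r_cylS rP.
Qed.

(** This plays the role of conditioning on the next gap: the cylinder splits over its values with
    weights [mu], and bounds on the pieces are averaged. The companion for the next mode averages
    with a row of [Pm]. *)
Lemma le_cyl_tau E q v k s x (c : nat -> R) l : measurable E ->
  (forall t, x * pr (cyl q.+1 (upd v q t) k s `&` E) <=
             pr (cyl q.+1 (upd v q t) k s) * c t) ->
  has_mean mu c l ->
  x * pr (cyl q v k s `&` E) <= pr (cyl q v k s) * l.
Proof.
move=> mE step cl; have mA : measurable (cyl q v k s `&` E).
  by apply: measurableI => //; exact: measurable_cyl.
pose u n := x * series (fun t => pr (cyl q v k s `&` E `&` [set w | tau q w = t])) n.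
have h1 : u @ \oo --> x * pr (cyl q v k s `&` E).
  by apply: cvgMl_tmp; exact: pr_partition_nat.
have h2 := has_meanZ (c := pr (cyl q v k s)) cl.
apply: (ler_cvg_to h1 h2); rewrite /u; apply: nearW => n; rewrite /series /= mulr_sumr.
apply: ler_sum => t _; rewrite setIAC -cyl_tauS (le_trans (step t)) //.
by rewrite pr_cyl_tauS mulrCA mulrA.
Qed.

Lemma le_cyl_r E q v k s x (c : 'I_M -> R) : measurable E ->
  (forall j, x * pr (cyl q v k.+1 (upd s k.+1 j) `&` E) <=
             pr (cyl q v k.+1 (upd s k.+1 j)) * c j) ->
  x * pr (cyl q v k s `&` E) <= pr (cyl q v k s) * \sum_j Pm (s k) j * c j.
Proof.
move=> mE step; have mA : measurable (cyl q v k s `&` E).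
  by apply: measurableI => //; exact: measurable_cyl.
rewrite -(pr_partition_ord P mA (mr k.+1)) !mulr_sumr; apply: ler_sum => j _.
by rewrite setIAC -cyl_rS (le_trans (step j)) // pr_cyl_rS mulrA.
Qed.

(** That [mu] is a probability distribution is read off from the cylinders with a single gap, here
    and in the next lemma. *)
Lemma mu_ge0 t : 0 <= mu t.
Proof.
have := tauP 1 (fun=> t); rewrite big_ord1 => /(congr1 fine) /= <-.
exact: fine_ge0.
Qed.

Lemma mu_mass : series mu @ \oo --> (1 : R).
Proof.
have := pr_partition_nat (P := P) measurableT (mtau 0).
rewrite /pr probability_setT /= (_ : (fun t => _) = mu) //.
apply/funext => t; rewrite setTI; have := tauP 1 (fun=> t); rewrite big_ord1.
move/(congr1 fine) => /= <-; congr (fine (P _)); apply/seteqP; split=> w /=.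
  by move=> wt i; rewrite ltnS leqn0 => /eqP ->.
by move=> h; exact: h.
Qed.

Lemma mu_zero : (forall i w, (0 < tau i w)%N) -> mu 0%N = 0.
Proof.
move=> tau0; have := tauP 1 (fun=> 0%N); rewrite big_ord1.
rewrite (_ : tau_cyl _ _ _ = set0) ?measure0; first by move/(congr1 fine).
by apply/seteqP; split=> // w h; have := tau0 0%N w; rewrite h.
Qed.

(** The term [G] rides along: modes are frozen one by one, and two discretely measurable functions
    are never added. *)
Lemma dmeas_blkD F k j (G : T -> R) : dmeas G ->
  dmeas (fun w => G w + blk F (r^~ w) k j).
Proof.
move=> mG; elim: j => [|j IH].
  have := mG; congr (dmeas _); apply/funext => w.
  by rewrite /blk big_ord0 addr0.
under eq_fun do rewrite blkS.
apply: (@dmeas_bind _ _ _ _ (r k) (fun a w =>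
  G w + (blk F (r^~ w) k j + F a (r (k + j)%N w)))) => // a.
apply: (@dmeas_bind _ _ _ _ (r (k + j)%N) (fun c w =>
  G w + (blk F (r^~ w) k j + F a c))) => // c.
by under eq_fun do rewrite addrA; exact: (dmeas_comp (fun x => x + F a c) IH).
Qed.

Lemma dmeas_tsum q : dmeas (fun w => tsum (tau^~ w) q).
Proof.
elim: q => [|q IH]; first by under eq_fun do rewrite tsum0; exact: dmeas_cst.
under eq_fun do rewrite tsumS.
apply: (@dmeas_bind _ _ _ _ (tau q) (fun t w => (tsum (tau^~ w) q + t)%N)) => // t.
exact: (dmeas_comp (fun y => (y + t)%N) IH).
Qed.

Lemma measurable_tsum q k : measurable [set w | tsum (tau^~ w) q = k].
Proof. exact: (dmeas_tsum q [set k]). Qed.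

Lemma dmeas_bscore b F q : dmeas (fun w => bscore b F (tau^~ w) (r^~ w) q).
Proof.
elim: q => [|q IH].
  by under eq_fun do rewrite /bscore big_ord0; exact: dmeas_cst.
under eq_fun do rewrite /bscore big_ord_recr /=.
apply: (@dmeas_bind _ _ _ _ (tau q) (fun t w => bscore b F (tau^~ w) (r^~ w) q +
  blk (trunc b t F) (r^~ w) (tsum (tau^~ w) q) t)) => // t.
apply: (@dmeas_bind _ _ _ _ (fun w => tsum (tau^~ w) q)
  (fun k w => bscore b F (tau^~ w) (r^~ w) q + blk (trunc b t F) (r^~ w) k t)) => [k|k].
  exact: measurable_tsum.
exact: dmeas_blkD.
Qed.

Lemma dmeas_ascore b F h eta q :
  dmeas (fun w => ascore b F h eta (tau^~ w) (r^~ w) q).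
Proof.
rewrite /ascore; apply: (@dmeas_bind _ _ _ _ (r 0%N) (fun c w =>
  bscore b F (tau^~ w) (r^~ w) q + h (r (tsum (tau^~ w) q) w) - h c + eta * q%:R)) => // c.
apply: (@dmeas_bind _ _ _ _ (fun w => tsum (tau^~ w) q) (fun k w =>
  bscore b F (tau^~ w) (r^~ w) q + h (r k w) - h c + eta * q%:R)) => [k|k].
  exact: measurable_tsum.
apply: (@dmeas_bind _ _ _ _ (r k) (fun a w =>
  bscore b F (tau^~ w) (r^~ w) q + h a - h c + eta * q%:R)) => // a.
exact: (dmeas_comp (fun x => x + h a - h c + eta * q%:R) (dmeas_bscore b F q)).
Qed.

(** The lower index [q] lets the induction drop the block already inspected. *)
Definition exceed b F h eta x N q : set T :=
  [set w | exists p, (q <= p <= N)%N /\ x <= ascore b F h eta (tau^~ w) (r^~ w) p].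

Lemma measurable_exceed b F h eta x N q : measurable (exceed b F h eta x N q).
Proof.
apply: measurable_bigcup_count => p; case: (boolP (q <= p <= N)%N) => qpN.
  rewrite (_ : (fun=> _) = (fun w => ascore b F h eta (tau^~ w) (r^~ w) p) @^-1` [set y | x <= y]).
    exact: dmeas_ascore.
  by apply/seteqP; split=> [w []//|w] /=.
by rewrite (_ : (fun=> _) = set0) //; apply/seteqP; split=> // w [].
Qed.

(** * Backward induction for the running maximum of the score *)

Section Maximal.
Variables (b : nat) (F : 'I_M -> 'I_M -> R) (h : 'I_M -> R) (eta C H x V : R) (N : nat).
Hypothesis sP : stochastic Pm.
Hypothesis FC : forall a c, `|F a c| <= C.
Hypothesis hH : forall a, `|h a| <= H.
Hypothesis eta0 : 0 <= eta.
Hypothesis x0 : 0 < x.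
(** A bound for the squared increment over a block of length [t], from [(B + e)^2 <= 2 B^2 + 2 e^2];
    its mean is [V]. *)
Let Dbd (t : nat) : R :=
  2 * (C * (if (t <= b)%N then t%:R else 0)) ^+ 2 + 2 * (2 * H + eta) ^+ 2.
Hypothesis VE : has_mean mu Dbd V.
Hypothesis drift : forall a, exists2 l, has_mean mu (fun t => lin Pm (trunc b t F) h a t a) l &
  l <= h a - eta.
Local Notation score := (ascore b F h eta).
Local Notation pos y := (Num.max y 0).

(** Second-order Taylor bound for the squared positive part, whose derivative [2 * pos A] is
    2-Lipschitz. *)
Lemma sqr_pos_le (A D : R) : pos (A + D) ^+ 2 <= pos A ^+ 2 + 2 * pos A * D + D ^+ 2.
Proof.
have D2 := sqr_ge0 D.
case: (leP A 0) => A0; case: (leP (A + D) 0) => AD0; rewrite ?expr0n /=; try nra.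
Qed.

Lemma sqr_le_of_norm (y Y : R) : `|y| <= Y -> y ^+ 2 <= Y ^+ 2.
Proof.
move=> yY; rewrite -(real_normK (num_real y)) lerXn2r ?nnegrE //.
exact: le_trans yY.
Qed.

Lemma block_increment_le s k t c :
  (blk (trunc b t F) s k t + h (s c) - h (s k) + eta) ^+ 2 <= Dbd t.
Proof.
set B := blk _ _ _ _; have B1 : `|B| <= C * (if (t <= b)%N then t%:R else 0).
  rewrite /B /trunc; case: ifP => _; first exact: norm_blk_le.
  by rewrite mulr0 /blk big1 ?normr0.
have E1 : `|h (s c) - h (s k) + eta| <= 2 * H + eta.
  apply: le_trans (ler_normD _ _) _; rewrite (ger0_norm eta0) lerD2r.
  by apply: le_trans (ler_normB _ _) _; rewrite mulr_natl mulr2n lerD.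
have := sqr_le_of_norm B1; have := sqr_le_of_norm E1; rewrite /Dbd.
set e := h (s c) - h (s k) + eta; have -> : B + h (s c) - h (s k) + eta = B + e.
  by rewrite /e; ring.
by have := sqr_ge0 (B - e); nra.
Qed.

Lemma sum_affine (p u : 'I_M -> R) al be ga : \sum_e p e = 1 ->
  \sum_e p e * (al + be * (ga + u e)) = al + be * (ga + \sum_e p e * u e).
Proof.
move=> p1; transitivity (\sum_e (p e * (al + be * ga) + be * (p e * u e))).
  by apply: eq_bigr => e _; ring.
by rewrite big_split /= -mulr_suml -mulr_sumr p1; ring.
Qed.

(** Backward induction inside one block of known length, with [l] steps made and [j] remaining. The
    cross term carries the conditional mean of the increment: the realised part [blk] plus the
    expected rest [lin]. The end of the block is the Taylor bound; each earlier step averages over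
    the next mode. *)
Lemma block_bound q v k :
  (forall s, x ^+ 2 * pr (cyl q.+1 v (tsum v q.+1) s `&` exceed b F h eta x N q.+1) <=
     pr (cyl q.+1 v (tsum v q.+1) s) * (pos (score v s q.+1) ^+ 2 + k%:R * V)) ->
  forall j l s, (l + j)%N = v q ->
  x ^+ 2 * pr (cyl q.+1 v (tsum v q + l) s `&` exceed b F h eta x N q.+1) <=
  pr (cyl q.+1 v (tsum v q + l) s) *
    (pos (score v s q) ^+ 2 + Dbd (v q) + k%:R * V + 2 * pos (score v s q) *
      (blk (trunc b (v q) F) s (tsum v q) l
       + lin Pm (trunc b (v q) F) h (s (tsum v q)) j (s (tsum v q + l)%N)
       - h (s (tsum v q)) + eta)).
Proof.
move=> IH; elim=> [|j IHj] l s lj.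
  rewrite addn0 in lj; rewrite lj -tsumS (le_trans (IH s)) // ler_wpM2l ?pr_ge0 //.
  rewrite lin0 ascoreS tsumS.
  have := block_increment_le s (tsum v q) (v q) (tsum v q + v q).
  set D := _ + eta; have := sqr_pos_le (score v s q) D.
  by move: (pos _ ^+ 2) (pos _ ^+ 2) (D ^+ 2) => a1 a2 a3; lra.
set T0 := tsum v q; set F' := trunc b (v q) F.
set A := pos (score v s q).
pose c e := A ^+ 2 + Dbd (v q) + k%:R * V + 2 * A *
  (blk F' s T0 l.+1 - h (s T0) + eta + lin Pm F' h (s T0) j e).
have -> : A ^+ 2 + Dbd (v q) + k%:R * V + 2 * A *
    (blk F' s T0 l + lin Pm F' h (s T0) j.+1 (s (T0 + l)%N) - h (s T0) + eta) =
    (* The bound is affine in the expected rest and the row of [Pm] sums to 1, so averaging passes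
       inside. *)
    \sum_e Pm (s (T0 + l)%N) e * c e.
  have [_ P1] := sP; rewrite /c sum_affine // linS blkS.
  by congr (_ + _ * _); ring.
apply: le_cyl_r => [|e]; first exact: measurable_exceed.
have sE i : (i <= T0 + l)%N -> upd s (T0 + l).+1 e i = s i.
  by move=> il; rewrite upd_lt // ltnS.
have := IHj l.+1 (upd s (T0 + l).+1 e); rewrite addSnnS => /(_ lj).
rewrite -/T0 -/F' addnS upd_same sE ?leq_addr //.
have -> : score v (upd s (T0 + l).+1 e) q = score v s q.
  by apply: ascore_ext => // i iT; apply: sE; exact: leq_trans iT (leq_addr _ _).
have -> : blk F' (upd s (T0 + l).+1 e) T0 l.+1 = blk F' s T0 l.+1.
  rewrite /blk; apply: eq_bigr => i _; rewrite !sE ?leq_addr //.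
  by rewrite leq_add2l -ltnS.
rewrite -/A; congr (_ <= _ * (_ + _ * _)); rewrite /c; ring.
Qed.

Lemma Dbd_ge0 t : 0 <= Dbd t.
Proof. by rewrite addr_ge0 // mulr_ge0 // sqr_ge0. Qed.

Lemma V_ge0 : 0 <= V.
Proof.
apply: (has_mean_le mu_ge0 Dbd_ge0 _ VE).
by have := has_mean_cst (c := 0) mu_mass.
Qed.

(* Once the score has reached [x] the bound is trivial, so the induction controls
   the running maximum and not only the final score. *)
Lemma maximal_cyl k q v s : (q + k)%N = N ->
  x ^+ 2 * pr (cyl q v (tsum v q) s `&` exceed b F h eta x N q) <=
  pr (cyl q v (tsum v q) s) * (pos (score v s q) ^+ 2 + k%:R * V).
Proof.
have mI q' v' k' s' p : measurable (cyl q' v' k' s' `&` exceed b F h eta x N p).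
  by apply: measurableI; [exact: measurable_cyl|exact: measurable_exceed].
have scoreE q' v' s' w : cyl q' v' (tsum v' q') s' w ->
    score (tau^~ w) (r^~ w) q' = score v' s' q'.
  move=> [tw rw]; apply: ascore_ext => [i /tw//|l].
  by rewrite (tsum_ext (v' := v')) => [/rw|i /tw].
elim: k q v s => [|k IH] q v s qk.
  case: (leP x (score v s q)) => xs.
    rewrite mul0r addr0 mulrC ler_pM ?sqr_ge0 ?pr_ge0 //.
      by apply: le_pr => //; exact: measurable_cyl.
    by rewrite lerXn2r ?nnegrE ?le_max ?lexx ?orbT ?xs // ltW.
  rewrite (_ : _ `&` _ = set0) ?/pr ?measure0 ?mulr0.
    by rewrite mulr_ge0 ?fine_ge0 // mul0r addr0 sqr_ge0.
  apply/seteqP; split=> // w [cw [p [/andP[qp pN]]]].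
  have -> : p = q by apply/eqP; rewrite eqn_leq qp -qk addn0 in pN *; rewrite pN.
  by rewrite (scoreE _ _ _ _ cw) leNgt xs.
have V0 := V_ge0; case: (leP x (score v s q)) => xs.
  rewrite mulrC ler_pM ?sqr_ge0 ?pr_ge0 //.
    by apply: le_pr => //; exact: measurable_cyl.
  apply: (@le_trans _ _ (pos (score v s q) ^+ 2)); last by rewrite lerDl mulr_ge0.
  by rewrite lerXn2r ?nnegrE ?le_max ?lexx ?orbT ?xs // ltW.
(* The score is still below [x] at block [q], so the level can only be reached later. *)
apply: (@le_trans _ _ (x ^+ 2 *
    pr (cyl q v (tsum v q) s `&` exceed b F h eta x N q.+1))).
  rewrite ler_wpM2l ?sqr_ge0 // le_pr // => w [cw [p [/andP[qp pN] xp]]].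
  split=> //; exists p; split=> //; rewrite pN andbT ltn_neqAle qp andbT.
  by apply/eqP => qp'; move: xp; rewrite -qp' (scoreE _ _ _ _ cw) leNgt xs.
set A := pos (score v s q); set a := s (tsum v q).
have [l lE la] := drift a.
have A0 : 0 <= A by rewrite le_max lexx orbT.
pose c t := A ^+ 2 + Dbd t + k%:R * V + 2 * A *
  (lin Pm (trunc b t F) h a t a - h a + eta).
have cE : has_mean mu c (A ^+ 2 + V + k%:R * V + 2 * A * (l - h a + eta)).
  have cst := fun y : R => has_mean_cst (c := y) mu_mass.
  apply: has_meanD.
    by apply: has_meanD (cst _); exact: has_meanD (cst _) VE.
  by apply: has_meanZ; apply: has_meanD (cst _); exact: has_meanD lE (cst _).
apply: (@le_trans _ _ (pr (cyl q v (tsum v q) s) *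
    (A ^+ 2 + V + k%:R * V + 2 * A * (l - h a + eta)))).
  apply: le_cyl_tau cE => [|t]; first exact: measurable_exceed.
  have tE : tsum (upd v q t) q = tsum v q.
    by apply: tsum_ext => i iq; rewrite upd_lt.
  have IHt s' := IH q.+1 (upd v q t) s' (etrans (addSnnS _ _) qk).
  have := block_bound IHt (j := t) (l := 0) s.
  rewrite upd_same add0n addn0 tE => /(_ erefl).
  have -> : score (upd v q t) s q = score v s q.
    by apply: ascore_ext => // i iq; rewrite upd_lt.
  by rewrite -/A -/a /blk big_ord0 add0r.
rewrite ler_wpM2l ?pr_ge0 // -natr1.
(* The supermartingale property: the drift hypothesis and [0 <= A] remove the cross term. *)
have : 2 * A * (l - h a + eta) <= 0 by rewrite mulr_ge0_le0 ?mulr_ge0 //; lra.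
by lra.
Qed.

Lemma maximal_ineq : x ^+ 2 * pr (exceed b F h eta x N 0) <= N%:R * V.
Proof.
have V0 := V_ge0.
have [[w0 _]|T0] := pselect (exists w : T, True); last first.
  rewrite (_ : exceed _ _ _ _ _ _ _ = set0) /pr ?measure0 ?mulr0 ?mulr_ge0 //.
  by apply/seteqP; split=> // w; case: T0; exists w.
have := @maximal_cyl N 0 (fun=> 0%N) (fun=> r 0 w0) (add0n N).
rewrite tsum0 cyl0 ?setTI // /pr probability_setT mul1r => /le_trans; apply.
rewrite /ascore /bscore big_ord0 mulr0 addr0 add0r subrr maxxx expr0n add0r.
exact: lexx.
Qed.

End Maximal.

Lemma measurable_large_gap b q N :
  measurable [set w | exists i, (q <= i < N)%N /\ (b < tau i w)%N].
Proof.
apply: measurable_bigcup_count => i; case: (boolP (q <= i < N)%N) => qi.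
  rewrite (_ : (fun=> _) = tau i @^-1` [set t | (b < t)%N]).
    by apply: (dmeas_fiber (mtau i)).
  by apply/seteqP; split=> [w []//|w] /=.
by rewrite (_ : (fun=> _) = set0) //; apply/seteqP; split=> // w [].
Qed.

(** A union bound, obtained by the same backward induction because the law of the gaps is given
    through cylinders: a long next gap costs at most the whole cylinder. *)
Lemma pr_large_gap b N l : has_mean mu (fun t => if (t <= b)%N then 0 else 1) l ->
  pr [set w | exists i, (i < N)%N /\ (b < tau i w)%N] <= N%:R * l.
Proof.
move=> tl; pose E q := [set w | exists i, (q <= i < N)%N /\ (b < tau i w)%N].
have mE q : measurable (E q) by exact: measurable_large_gap.
have l0 : 0 <= l.
  apply: (has_mean_le mu_ge0 _ (has_mean_cst (c := 0) mu_mass) tl) => t.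
  by case: ifP.
have mI q v k s p : measurable (cyl q v k s `&` E p).
  by apply: measurableI => //; exact: measurable_cyl.
have main k q v s : (q + k)%N = N ->
    1 * pr (cyl q v 0 s `&` E q) <= pr (cyl q v 0 s) * (k%:R * l).
  elim: k q v => [|k IH] q v qk.
    rewrite (_ : _ `&` _ = set0) /pr ?measure0 ?mul0r ?mulr0 //.
    by apply/seteqP; split=> // w [_ [i [/andP[qi]]]]; rewrite -qk addn0 ltnNge qi.
  have tlk := has_meanD tl (has_mean_cst (c := k%:R * l) mu_mass).
  have -> : k.+1%:R * l = l + k%:R * l by rewrite -natr1; ring.
  apply: le_cyl_tau tlk => // t.
  rewrite mul1r; have [tb|bt] := leqP t b; last first.
    apply: (@le_trans _ _ (pr (cyl q.+1 (upd v q t) 0 s))).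
      by apply: le_pr => //; exact: measurable_cyl.
    by rewrite ler_peMr ?pr_ge0 // lerDl mulr_ge0.
  rewrite add0r; have := IH q.+1 (upd v q t); rewrite mul1r addSnnS => /(_ qk).
  apply: le_trans; apply: le_pr => // w [cw [i [/andP[qi iN] bi]]].
  split=> //; exists i; split=> //; rewrite iN andbT ltn_neqAle qi andbT.
  apply/eqP => qi'; move: cw; rewrite cyl_tauS => -[_ /=].
  by rewrite qi' => tw; move: bi; rewrite tw ltnNge tb.
have [[w0 _]|T0] := pselect (exists w : T, True); last first.
  rewrite (_ : mkset _ = set0) /pr ?measure0 ?mulr_ge0 //.
  by apply/seteqP; split=> // w; case: T0; exists w.
have := main N 0%N (fun=> 0%N) (fun=> r 0 w0) (add0n N).
by rewrite cyl0 ?setTI // mul1r /pr probability_setT mul1r.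
Qed.

(** * Dyadic scales and Borel-Cantelli *)

Section BorelCantelli.
Variables (F : 'I_M -> 'I_M -> R) (h : 'I_M -> R) (eta C H : R) (n1 : nat).
Hypothesis sP : stochastic Pm.
Hypothesis FC : forall a c, `|F a c| <= C.
Hypothesis hH : forall a, `|h a| <= H.
Hypothesis eta0 : 0 <= eta.
Hypothesis mean_tau : cvg (series (fun t : nat => t%:R * mu t) @ \oo).
Hypothesis drift : forall n a, (n1 <= n)%N -> exists2 l,
  has_mean mu (fun t => lin Pm (trunc (2 ^ n) t F) h a t a) l & l <= h a - eta.
Variables (D : nat) (eps : R).
Hypotheses (D0 : (0 < D)%N) (eps0 : 0 < eps).
Local Notation N n := (D * 2 ^ n)%N.
Local Notation trc n := (fun t : nat => if (t <= 2 ^ n)%N then t%:R else 0 : R).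

(** Scales below [n1] are left out because the truncated drift is only known to be negative from
    [n1] on. *)
Definition bad n : set T := if (n < n1)%N then set0 else
  [set w | exists i, (i < N n)%N /\ (2 ^ n < tau i w)%N] `|`
  exceed (2 ^ n) F h eta (eps * (N n)%:R) (N n) 0.

Lemma measurable_bad n : measurable (bad n).
Proof.
rewrite /bad; case: ifP => // _; apply: measurableU; last exact: measurable_exceed.
exact: (measurable_large_gap _ 0).
Qed.

(** A geometric sum over the scales [2^n < t], dominated by its last term. The minimum with [2^k]
    makes the induction close. *)
Lemma sum_pow_lt (t k : nat) :
  \sum_(n < k) 2 ^+ n * (if (t <= 2 ^ n)%N then 0 else 1) <= 2 * t%:R :> R.
Proof.
suff : \sum_(n < k) 2 ^+ n * (if (t <= 2 ^ n)%N then 0 else 1) <=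
    Num.min (2 * t%:R) (2 ^+ k) :> R by rewrite le_min => /andP[].
elim: k => [|k IH]; first by rewrite big_ord0 le_min mulr_ge0 // expr0 ler01.
rewrite big_ord_recr /=; move: IH; rewrite !le_min => /andP[IH1 IH2].
have p0 : 0 < 2 ^+ k :> R by rewrite exprn_gt0.
case: leqP => tk; rewrite ?mulr0 ?addr0 ?mulr1.
  by rewrite IH1 (le_trans IH2) // exprS ler_peMl ?ler1n // ltW.
have : 2 ^+ k <= t%:R :> R by rewrite -natrX ler_nat ltnW.
by rewrite exprS => kt; apply/andP; split; lra.
Qed.

(** Only scales [2^n >= t] contribute, a geometric tail of size at most [t^2 * (2 / t)]. The
    induction keeps the remainder of the tail; the maximum with 0 covers the scales before it
    starts. *)
Lemma sum_trc_sqr (t k : nat) : \sum_(n < k) (trc n t) ^+ 2 / 2 ^+ n <= 2 * t%:R :> R.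
Proof.
suff : \sum_(n < k) (trc n t) ^+ 2 / 2 ^+ n <=
    Num.max 0 (2 * t%:R - 2 * t%:R ^+ 2 / 2 ^+ k) :> R.
  move/le_trans; apply; rewrite ge_max mulr_ge0 //= gerBl.
  by rewrite divr_ge0 ?exprn_ge0 // mulr_ge0 // exprn_ge0.
elim: k => [|k IH]; first by rewrite big_ord0 le_max lexx.
have p0 : 0 < 2 ^+ k :> R by rewrite exprn_gt0.
rewrite big_ord_recr /=; apply: le_trans (lerD IH (lexx _)) _.
case: leqP => tk; last first.
  rewrite expr0n mul0r addr0 ge_max le_max lexx /=.
  have kt : 2 ^+ k <= t%:R :> R by rewrite -natrX ler_nat ltnW.
  rewrite le_max subr_le0 ler_pdivlMr //.
  by apply/orP; left; rewrite expr2 mulrA ler_wpM2l // mulr_ge0.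
have kt : t%:R <= 2 ^+ k :> R by rewrite -natrX ler_nat.
have e0 : 0 <= t%:R ^+ 2 / 2 ^+ k :> R by rewrite divr_ge0 ?exprn_ge0 // ltW.
rewrite max_r; last first.
  by rewrite subr_ge0 -mulrA ler_wpM2l // ler_pdivrMr // expr2 ler_wpM2l.
rewrite le_max; apply/orP; right; rewrite [2 ^+ k.+1]exprS invfM.
have -> : 2 * t%:R ^+ 2 * (2^-1 * (2 ^+ k)^-1) = t%:R ^+ 2 / 2 ^+ k :> R.
  by field; rewrite gt_eqF.
by rewrite -mulrA; lra.
Qed.

Lemma sum_half (k : nat) : \sum_(n < k) (2 ^+ n)^-1 <= 2 :> R.
Proof.
suff : \sum_(n < k) (2 ^+ n)^-1 <= 2 - 2 / 2 ^+ k :> R.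
  by move/le_trans; apply; rewrite gerBl divr_ge0 // exprn_ge0.
elim: k => [|k IH]; first by rewrite big_ord0 expr0 divr1 subrr.
have p0 : 0 < (2 ^+ k)^-1 :> R by rewrite invr_gt0 exprn_gt0.
by rewrite big_ord_recr /= exprS invfM; lra.
Qed.

(** Exchanging the sum over scales with the mean over gaps reduces the long-gap probabilities and
    the truncated second moments to the first moment of [mu], by the two geometric bounds. *)
Lemma bad_summable : (\sum_(n <oo) P (bad n) < +oo)%E.
Proof.
have mu0 := mu_ge0.
have m1 := mu_mass.
have [m mE] : exists m, has_mean mu (fun t => t%:R) m.
  apply: (has_mean_dominated (C := 1)) => // t.
  by rewrite ger0_norm // mul1r lerDr.
have tex n : exists l, has_mean mu (fun t => if (t <= 2 ^ n)%N then 0 else 1) l.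
  apply: (has_mean_dominated (C := 1)) => // t; rewrite mul1r.
  by case: ifP => _; rewrite ?normr0 ?normr1 ?addr_ge0 // lerDl.
have [tl tlE] := choice tex.
have vex n : exists l, has_mean mu (fun t => (trc n t) ^+ 2) l.
  have := has_mean_finite (mu := mu) (u := fun t => t%:R ^+ 2) (b := 2 ^ n); set l := series _ _.
  move=> hl; exists l; move: hl; congr (has_mean _ _ _); apply/funext => t.
  by case: ifP => // _; rewrite expr0n.
have [m2 m2E] := choice vex.
pose V n := 2 * C ^+ 2 * m2 n + 2 * (2 * H + eta) ^+ 2.
have VE n : has_mean mu (fun t => 2 * (C * trc n t) ^+ 2 + 2 * (2 * H + eta) ^+ 2) (V n).
  apply: has_meanD (has_mean_cst (c := _) m1).
  have := has_meanZ (c := 2 * C ^+ 2) (m2E n); congr (has_mean _ _ _).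
  by apply/funext => t; set y := (if _ then _ else _); ring.
pose K := D%:R * eps ^+ 2; have K0 : 0 < K by rewrite mulr_gt0 ?exprn_gt0 ?ltr0n.
(* The union bound over [D 2^n] gaps, plus [N V / (eps N)^2] with [N = D 2^n] from the maximal
   inequality. *)
pose g n := D%:R * (2 ^+ n * tl n) + V n / 2 ^+ n / K.
have p0 n : 0 < 2 ^+ n :> R by rewrite exprn_gt0.
have tl0 n : 0 <= tl n.
  apply: (has_mean_le mu0 _ (has_mean_cst (c := 0) m1) (tlE n)) => t.
  by case: ifP.
have m20 n : 0 <= m2 n.
  apply: (has_mean_le mu0 _ (has_mean_cst (c := 0) m1) (m2E n)) => t.
  exact: sqr_ge0.
have V0 n : 0 <= V n.
  by rewrite /V; have := sqr_ge0 C; have := sqr_ge0 (2 * H + eta); have := m20 n; nra.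
have badg n : pr (bad n) <= g n.
  rewrite /bad; case: ltnP => n1n.
    have e1 : 0 <= 2 ^+ n * tl n by rewrite mulr_ge0 // ltW.
    have e2 : 0 <= V n / 2 ^+ n by rewrite divr_ge0 // ltW.
    rewrite /pr measure0 addr_ge0 //; first by rewrite mulr_ge0.
    by rewrite divr_ge0 // ltW.
  have NE : (N n)%:R = D%:R * 2 ^+ n :> R by rewrite natrM natrX.
  have N0 : 0 < D%:R * 2 ^+ n :> R by rewrite mulr_gt0 ?ltr0n.
  apply: le_trans (prU_le _ _ _) _.
  - exact: (measurable_large_gap _ 0).
  - exact: measurable_exceed.
  apply: lerD; first by rewrite mulrA -NE; apply: pr_large_gap.
  have x0 : 0 < eps * (N n)%:R by rewrite NE mulr_gt0.
  have := maximal_ineq (N n) sP FC hH eta0 x0 (VE n) (fun a => drift a n1n).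
  rewrite NE mulrC -ler_pdivlMr ?exprn_gt0 -?NE // => /le_trans; apply.
  rewrite NE /K le_eqVlt; apply/orP; left; apply/eqP; field.
  by rewrite !gt_eqF // ltr0n.
pose B := D%:R * (2 * m) + (2 * C ^+ 2 * (2 * m) + 2 * (2 * H + eta) ^+ 2 * 2) / K.
have sumg k : \sum_(n < k) g n <= B.
  rewrite big_split /= -mulr_sumr; apply: lerD.
    rewrite ler_wpM2l //; apply: (has_mean_le mu0 (sum_pow_lt^~ k) _ (has_meanZ (c := 2) mE)).
    by apply: (has_mean_sum (s := index_enum _)) => n; apply: has_meanZ.
  rewrite -mulr_suml ler_wpM2r ?invr_ge0 ?(ltW K0) //.
  have -> : \sum_(n < k) V n / 2 ^+ n = 2 * C ^+ 2 * (\sum_(n < k) m2 n / 2 ^+ n) +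
      2 * (2 * H + eta) ^+ 2 * \sum_(n < k) (2 ^+ n)^-1.
    by rewrite !mulr_sumr -big_split; apply: eq_bigr => n _; rewrite /V /=; ring.
  have c0 (y : R) : 0 <= 2 * y ^+ 2 by rewrite mulr_ge0 // sqr_ge0.
  apply: lerD; last by rewrite ler_wpM2l ?sum_half.
  rewrite ler_wpM2l //.
  apply: (has_mean_le mu0 (sum_trc_sqr^~ k) _ (has_meanZ (c := 2) mE)).
  apply: (has_mean_sum (s := index_enum _)) => n.
  have := has_meanZ (c := (2 ^+ n)^-1) (m2E n); rewrite mulrC.
  by congr (has_mean _ _ _); apply/funext => t; rewrite mulrC.
apply: (@le_lt_trans _ _ B%:E); last exact: ltry.
apply: lime_le; first by apply: is_cvg_nneseries.
apply: nearW => k; under eq_bigr do rewrite (prE P (measurable_bad _)).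
rewrite sumEFin lee_fin big_mkord; apply: le_trans (sumg k).
by apply: ler_sum => n _; exact: badg.
Qed.

Lemma borel_cantelli_bad : exists Z : set T, [/\ measurable Z, P Z = 0%E &
  forall w, ~ Z w -> exists n0, forall n, (n0 <= n)%N ->
    (forall i, (i < N n)%N -> (tau i w <= 2 ^ n)%N) /\
    (forall p, (p <= N n)%N ->
      ascore (2 ^ n) F h eta (tau^~ w) (r^~ w) p < eps * (N n)%:R)].
Proof.
exists (lim_sup_set bad); split.
- apply: bigcapT_measurable => n; apply: bigcup_measurable => j _.
  exact: measurable_bad.
- exact: lim_sup_set_cvg0 measurable_bad bad_summable.
move=> w nZ; have [n0 nb] : exists n0, forall n, (n0 <= n)%N -> ~ bad n w.
  apply: contrapT => nex; apply: nZ => n _; apply: contrapT => nbad.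
  by apply: nex; exists n => j nj bj; apply: nbad; exists j.
exists (maxn n0 n1) => n; rewrite geq_max => /andP[/nb nbn n1n].
move: nbn; rewrite /bad ltnNge n1n /= => /not_orP[nb1 nb2]; split=> [i iN|p pN].
  by rewrite leqNgt; apply/negP => bi; apply: nb1; exists i.
by rewrite ltNge; apply/negP => xp; apply: nb2; exists p.
Qed.

End BorelCantelli.

End Process.

(** * Pathwise consequences *)

Section Paths.
Context {T : Type} {R : realType} {M : nat}.
Variables (r : nat -> T -> 'I_M) (tau : nat -> T -> nat).
Hypothesis tau_gt0 : forall i w, (0 < tau i w)%N.
Implicit Types (F : 'I_M -> 'I_M -> R) (h : 'I_M -> R).
Local Notation t_ w := (tsum (tau^~ w)).

Lemma leq_tsum_id q w : (q <= t_ w q)%N.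
Proof.
elim: q => [//|q IH]; rewrite tsumS -addn1; exact: leq_add.
Qed.

Lemma count_procE k q w : (t_ w q <= k < t_ w q.+1)%N -> count_proc tau k w = q.
Proof.
move=> /andP[qk kq]; have qk' : (q <= k)%N := leq_trans (leq_tsum_id q w) qk.
rewrite /count_proc (@big_cat_nat _ _ _ q.+1) //=.
rewrite [X in (_ + X)%N]big_nat_cond [X in (_ + X)%N]big1 ?addn0; last first.
  move=> i /andP[/andP[qi _] _]; apply/eqP; rewrite eqb0 -ltnNge.
  exact: leq_trans kq (leq_tsum _ qi).
rewrite (eq_big_nat _ _ (F2 := fun=> 1%N)) ?sum_nat_const_nat ?muln1 ?subn1 // => i /andP[_].
by rewrite ltnS => iq; rewrite (leq_trans (leq_tsum _ iq) qk).
Qed.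

Lemma tsum_bracket k w : exists q, (t_ w q <= k < t_ w q.+1)%N.
Proof.
have ex0 : exists q, (t_ w q <= k)%N by exists 0%N; rewrite tsum0.
have ub q : (t_ w q <= k)%N -> (q <= k)%N by move/(leq_trans (leq_tsum_id q w)).
case: (ex_maxnP ex0 ub) => q qk qmax; exists q; rewrite qk ltnNge /=.
by apply/negP => /qmax; rewrite ltnn.
Qed.

Definition gain F k w : R :=
  \sum_(l < k) F (sampled_mode r tau l w) (r l w).

(** The sampled mode is constant during a block. Allowing [j = tau q w] makes the end of one block
    the start of the next, which links the inductions on [j] and on [q]. *)
Lemma gain_blocks F q j w : (j <= tau q w)%N ->
  gain F (t_ w q + j) w =
  \sum_(i < q) blk F (r^~ w) (t_ w i) (tau i w) + blk F (r^~ w) (t_ w q) j.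
Proof.
elim: q j => [|q IHq]; elim=> [|j IHj] jq.
- by rewrite tsum0 big_ord0 /blk /gain !big_ord0 add0r.
- rewrite addnS /gain big_ord_recr /= -/(gain _ _ _) IHj 1?ltnW // blkS addrA.
  congr (_ + F _ _); rewrite /sampled_mode (@count_procE _ 0) ?tsumS ?leq_addr //=.
  by rewrite ltn_add2l.
- rewrite addn0 tsumS IHq // big_ord_recr /= -!addrA; congr (_ + _).
  by rewrite /blk big_ord0 addr0.
- rewrite addnS /gain big_ord_recr /= -/(gain _ _ _) IHj 1?ltnW // blkS addrA.
  congr (_ + F _ _); rewrite /sampled_mode (@count_procE _ q.+1) //.
  by rewrite leq_addr /= [in X in (_ < X)%N]tsumS ltn_add2l.
Qed.

Lemma bscore_trunc b F q w : (forall i, (i < q)%N -> (tau i w <= b)%N) ->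
  bscore b F (tau^~ w) (r^~ w) q = \sum_(i < q) blk F (r^~ w) (t_ w i) (tau i w).
Proof.
move=> tb; apply: eq_bigr => i _; apply: eq_bigr => l _.
by rewrite /trunc tb.
Qed.

(** For [D 2^n <= q < D 2^(n+1)] the bounds of scale [n + 1] apply. The score error
    [(eta / 8) D 2^(n+1)] and the unfinished block, at most [C 2^(n+1)], are each at most
    [(eta / 4) q], the latter by [8 C <= D eta]; half of the drift [eta q] remains. *)
Lemma gain_le F h (eta C H : R) D n0 w : 0 < eta -> (0 < D)%N ->
  (forall a c, `|F a c| <= C) -> (forall a, `|h a| <= H) -> 8 * C <= D%:R * eta ->
  (forall n, (n0 <= n)%N ->
    (forall i, (i < D * 2 ^ n)%N -> (tau i w <= 2 ^ n)%N) /\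
    (forall p, (p <= D * 2 ^ n)%N ->
      ascore (2 ^ n) F h eta (tau^~ w) (r^~ w) p < eta / 8 * (D * 2 ^ n)%:R)) ->
  forall q k, (D * 2 ^ n0 <= q)%N -> (t_ w q <= k < t_ w q.+1)%N ->
  gain F k w <= 2 * H - eta / 2 * q%:R.
Proof.
move=> eta0 D0 FC hH CD good q k q0 /andP[qk kq].
pose n := trunc_log 2 (q %/ D).
have qD0 : (0 < q %/ D)%N.
  by rewrite divn_gt0 // (leq_trans _ q0) // leq_pmulr // expn_gt0.
have /andP[nq qn] := trunc_log_bounds (isT : (1 < 2)%N) qD0; rewrite -/n in nq qn.
have n0n : (n0 <= n.+1)%N.
  rewrite leqW // trunc_log_max // leq_divRL // mulnC //.
have Nq : (D * 2 ^ n <= q)%N by rewrite mulnC -leq_divRL.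
have qN : (q < D * 2 ^ n.+1)%N by rewrite mulnC -ltn_divLR.
have [tb sc] := good _ n0n.
have := sc q (ltnW qN); rewrite /ascore bscore_trunc; last first.
  by move=> i iq; apply: tb; exact: ltn_trans iq qN.
set j := (k - t_ w q)%N; have kE : k = (t_ w q + j)%N by rewrite subnKC.
have jt : (j <= tau q w)%N.
  by rewrite -(leq_add2l (t_ w q)) -kE -tsumS ltnW.
rewrite kE gain_blocks //; set S := \sum_(i < q) _.
have C0 : 0 <= C by apply: le_trans (FC (r 0 w) (r 0 w)).
have B1 : blk F (r^~ w) (t_ w q) j <= C * (2 ^ n.+1)%:R.
  apply: le_trans (ler_norm _) _; apply: le_trans (norm_blk_le _ _ _ FC) _.
  by rewrite ler_wpM2l // ler_nat (leq_trans jt) // tb.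
have h1 := hH (r (t_ w q) w); have h2 := hH (r 0%N w).
move: h1 h2; rewrite !ler_norml => /andP[h1 _] /andP[_ h2].
have NqR : D%:R * (2 ^ n)%:R <= q%:R :> R by rewrite -natrM ler_nat.
have p0 : 0 <= (2 ^ n)%:R :> R by [].
move: B1; rewrite expnS !natrM; set X := (2 ^ n)%:R in NqR p0 *.
set B := blk _ _ _ _; move=> B1 sc1.
have e1 : 8 * C * X <= D%:R * X * eta by rewrite [X in _ <= X]mulrAC ler_wpM2r.
have e2 : D%:R * X * eta <= q%:R * eta by rewrite ler_wpM2r // ltW.
by lra.
Qed.

Lemma gain_diverges F h (eta C H : R) D n0 w : 0 < eta -> (0 < D)%N ->
  (forall a c, `|F a c| <= C) -> (forall a, `|h a| <= H) -> 8 * C <= D%:R * eta ->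
  (forall n, (n0 <= n)%N ->
    (forall i, (i < D * 2 ^ n)%N -> (tau i w <= 2 ^ n)%N) /\
    (forall p, (p <= D * 2 ^ n)%N ->
      ascore (2 ^ n) F h eta (tau^~ w) (r^~ w) p < eta / 8 * (D * 2 ^ n)%:R)) ->
  forall B : R, exists k0, forall k, (k0 <= k)%N -> gain F k w <= B.
Proof.
move=> eta0 D0 FC hH CD good B.
pose q1 := Num.bound `|(2 * H - B) / (eta / 2)|.
pose q0 := maxn (D * 2 ^ n0) q1.
exists (t_ w q0) => k kq; have [q qk] := tsum_bracket k w.
have q0q : (q0 <= q)%N.
  rewrite leqNgt; apply/negP => qq0; case/andP: qk => _; rewrite ltnNge => /negP; apply.
  exact: leq_trans (leq_tsum _ qq0) kq.
have := leq_trans (leq_maxl _ _) q0q => /(gain_le eta0 D0 FC hH CD good)/(_ qk)/le_trans.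
apply; have q1q : q1%:R <= q%:R :> R by rewrite ler_nat (leq_trans (leq_maxr _ _) q0q).
have e2 : 0 < eta / 2 by rewrite divr_gt0.
have : (2 * H - B) / (eta / 2) <= q%:R.
  by apply: le_trans q1q; apply: le_trans (ler_norm _) _; exact/ltW/archi_boundP.
by rewrite ler_pdivrMr // => e; lra.
Qed.

End Paths.

(** * Almost sure divergence of the logarithmic gain *)

Section SampledMeasurability.
Context {R : realType} {d : measure_display} {T : measurableType d} {M : nat}.
Variables (r : nat -> T -> 'I_M) (tau : nat -> T -> nat).
Hypothesis mr : forall k i, measurable [set w | r k w = i].
Hypothesis mtau : forall i k, measurable [set w | tau i w = k].

Lemma dmeas_count_proc k : dmeas (count_proc tau k).
Proof.
rewrite /count_proc; elim: (X in index_iota _ X.+1) => [|m IH].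
  by under eq_fun do rewrite big_geq //; exact: dmeas_cst.
under eq_fun do rewrite big_nat_recr //=.
apply: (@dmeas_bind _ _ _ _ (obs_time tau m.+1) (fun t w =>
  (\sum_(1 <= i < m.+1) (obs_time tau i w <= k) + (t <= k))%N)) => [t|t].
  exact: measurable_tsum.
exact: (dmeas_comp (fun y => (y + (t <= k))%N) IH).
Qed.

Lemma dmeas_sampled_mode k : dmeas (sampled_mode r tau k).
Proof.
apply: (@dmeas_bind _ _ _ _ (count_proc tau k) (fun q w => r (obs_time tau q w) w)) => q.
  exact: (dmeas_count_proc k [set q]).
apply: (@dmeas_bind _ _ _ _ (obs_time tau q) r) => t; first exact: measurable_tsum.
exact: dmeas_fiber.
Qed.

Lemma dmeas_gain (F : 'I_M -> 'I_M -> R) k : dmeas (gain r tau F k).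
Proof.
rewrite /gain; elim: k => [|k IH].
  by under eq_fun do rewrite big_ord0; exact: dmeas_cst.
under eq_fun do rewrite big_ord_recr /=.
apply: (@dmeas_bind _ _ _ _ (sampled_mode r tau k) (fun a w =>
  \sum_(l < k) F (sampled_mode r tau l w) (r l w) + F a (r k w))) => a.
  exact: (dmeas_sampled_mode k [set a]).
apply: (@dmeas_bind _ _ _ _ (r k) (fun c w =>
  \sum_(l < k) F (sampled_mode r tau l w) (r l w) + F a c)) => // c.
exact: (dmeas_comp (fun y => y + F a c) IH).
Qed.

Lemma dmeas_state n m (A : 'I_M -> 'M[R]_n) (B : 'I_M -> 'M[R]_(n, m)) K x0 k :
  dmeas (state A B K r (sampled_mode r tau) x0 k).
Proof.
elim: k => [|k IH]; first exact: dmeas_cst.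
apply: (@dmeas_bind _ _ _ _ (sampled_mode r tau k) (fun a w =>
  let x := state A B K r (sampled_mode r tau) x0 k w in
  A (r k w) *m x + B (r k w) *m (K a *m x))) => a.
  exact: (dmeas_sampled_mode k [set a]).
apply: (@dmeas_bind _ _ _ _ (r k) (fun c w =>
  let x := state A B K r (sampled_mode r tau) x0 k w in
  A c *m x + B c *m (K a *m x))) => // c.
exact: (dmeas_comp (fun x => A c *m x + B c *m (K a *m x)) IH).
Qed.

End SampledMeasurability.

(** * Lyapunov bound along trajectories *)

Lemma lyapunov_state (R : realType) (T : Type) n m M
    (A : 'I_M -> 'M[R]_n) (B : 'I_M -> 'M[R]_(n, m)) (Rt : 'M[R]_n)
    (L : 'I_M -> 'M[R]_(m, n)) (zeta : 'I_M -> 'I_M -> R)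
    (r : nat -> T -> 'I_M) (tau : nat -> T -> nat) x0 k w :
  sym_posdef Rt -> (forall i j, 0 < zeta i j) ->
  (forall i j, neg_semidef
     ((A i *m Rt + B i *m L j)^T *m invmx Rt *m (A i *m Rt + B i *m L j)
        - zeta i j *: Rt)) ->
  qform (invmx Rt) (state A B (fun i => L i *m invmx Rt) r (sampled_mode r tau) x0 k w)
    <= expR (gain r tau (fun a c => ln (zeta c a)) k w) * qform (invmx Rt) x0.
Proof.
move=> pd z0 lmi; elim: k => [|k IH]; first by rewrite /gain big_ord0 expR0 mul1r.
rewrite /gain big_ord_recr /= -/(gain _ _ _ _ _) expRD lnK ?posrE //.
apply: le_trans (lyapunov_step _ pd (lmi _ _)) _.
by rewrite [X in _ <= X]mulrAC [X in _ <= X]mulrC ler_wpM2l // ltW.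
Qed.

(** The quadratic form is compared with the Euclidean norm at both ends. The constant depends
    neither on the initial state nor on the outcome, so one [delta] can serve all initial states. *)
Lemma state_norm_bound (R : realType) (T : Type) n m M
    (A : 'I_M -> 'M[R]_n) (B : 'I_M -> 'M[R]_(n, m)) (Rt : 'M[R]_n)
    (L : 'I_M -> 'M[R]_(m, n)) (zeta : 'I_M -> 'I_M -> R)
    (r : nat -> T -> 'I_M) (tau : nat -> T -> nat) :
  sym_posdef Rt -> (forall i j, 0 < zeta i j) ->
  (forall i j, neg_semidef
     ((A i *m Rt + B i *m L j)^T *m invmx Rt *m (A i *m Rt + B i *m L j)
        - zeta i j *: Rt)) ->
  exists2 c : R, 0 <= c & forall x0 k w,
  vnorm (state A B (fun i => L i *m invmx Rt) r (sampled_mode r tau) x0 k w) ^+ 2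
    <= c * expR (gain r tau (fun a c => ln (zeta c a)) k w) * vnorm x0 ^+ 2.
Proof.
move=> pd z0 lmi; have tr0 : 0 <= \tr Rt.
  apply: sumr_ge0 => i _; have := sym_posdef_qform_ge0 (delta_mx i 0) pd.
  by rewrite /qform trmx_delta -mulmxA -rowE -colE !mxE.
exists (\tr Rt * \sum_i \sum_j `|invmx Rt i j|).
  by rewrite mulr_ge0 // sumr_ge0 // => i _; rewrite sumr_ge0.
move=> x0 k w; apply: le_trans (vnorm_qform_invmx _ pd) _.
rewrite -!mulrA ler_wpM2l //; apply: le_trans (lyapunov_state _ _ _ _ _ pd z0 lmi) _.
by rewrite mulrCA ler_wpM2l ?expR_ge0 // qform_le_vnorm.
Qed.

(** * Divergence of the gain outside a null set *)

Lemma gain_diverges_ae (R : realType) (d : measure_display) (T : measurableType d)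
  (P : probability T R) (M : nat)
  (Pm : 'M[R]_M) (pi : 'I_M -> R) (r0 : 'I_M) (r : nat -> T -> 'I_M)
  (mu : nat -> R) (tau : nat -> T -> nat) (F : 'I_M -> 'I_M -> R) :
  stochastic Pm -> irreducible Pm -> aperiodic Pm -> invariant_distr Pm pi ->
  (forall k i, measurable [set w | r k w = i]) ->
  (forall w, r 0%N w = r0) ->
  (forall (k : nat) (s : nat -> 'I_M) (j : 'I_M),
     P (r_cyl r k s `&` [set w | r k.+1 w = j]) = (P (r_cyl r k s) * (Pm (s k) j)%:E)%E) ->
  (forall i k, measurable [set w | tau i w = k]) ->
  (forall i w, (0 < tau i w)%N) ->
  (forall (q : nat) (v : nat -> nat),
     P (tau_cyl tau q v) = (\prod_(i < q) mu (v i))%:E) ->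
  cvg (series (fun t : nat => t%:R * mu t) @ \oo) ->
  (forall (k : nat) (s : nat -> 'I_M) (q : nat) (v : nat -> nat),
     P (r_cyl r k s `&` tau_cyl tau q v) = (P (r_cyl r k s) * P (tau_cyl tau q v))%E) ->
  (exists s : R, s < 0 /\
     series (fun t : nat => mu t * \sum_(1 <= l < t.+1) \sum_i \sum_j
                pi i * (Pm ^+ l.-1) i j * F i j) @ \oo --> s) ->
  exists Z : set T, [/\ measurable Z, P Z = 0%E & forall w, ~ Z w ->
    forall B : R, exists k0, forall k, (k0 <= k)%N -> gain r tau F k w <= B].
Proof.
move=> sP iP aP ipi mr r00 rP mtau tau0 tauP mut indep [s [s0 sE]].
have mu0 := mu_ge0 tauP; have mu1 := mu_mass mtau tauP.
have mu00 := mu_zero tauP tau0.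
pose C : R := \sum_a \sum_c `|F a c|.
have FC a c : `|F a c| <= C.
  rewrite /C (bigD1 a) //= (bigD1 c) //= -addrA lerDl addr_ge0 ?sumr_ge0 // => i _.
  by rewrite sumr_ge0.
have C0 : 0 <= C by rewrite sumr_ge0 // => a _; rewrite sumr_ge0.
pose G t a := \sum_(l < t) \sum_e (Pm ^+ l) a e * F a e.
have GC t a : `|G t a| <= C * (1 + t%:R).
  apply: (@le_trans _ _ (\sum_(l < t) C)); last first.
    by rewrite sumr_const card_ord -[C *+ t]mulr_natr ler_wpM2l // lerDr.
  apply: le_trans (ler_norm_sum _ _ _) _; apply: ler_sum => l _.
  have [Pl0 Pl1] := stochastic_expr l sP.
  rewrite -[C]mul1r -(Pl1 a) mulr_suml; apply: le_trans (ler_norm_sum _ _ _) _.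
  by apply: ler_sum => e _; rewrite normrM (ger0_norm (Pl0 a e)) ler_wpM2l.
have Gs : has_mean mu (fun t => \sum_a pi a * G t a) s.
  move: sE; rewrite /has_mean; set u := (fun t => _); set v := (fun t => _).
  suff -> : u = v by []; apply/funext => t; congr (_ * _).
  (* The range [1 <= l <= t] with power [l - 1] is reindexed to [l < t] with power [l]. *)
  rewrite big_add1 /= big_mkord exchange_big /=; apply: eq_bigr => a _.
  rewrite /G mulr_sumr; apply: eq_bigr => l _; rewrite mulr_sumr.
  by apply: eq_bigr => e _; rewrite mulrA.
have [h hE] := poisson_equation sP iP aP ipi mu0 mu00 mu1 mut GC Gs.
have gex a : exists l, has_mean mu (G^~ a) l.
  by apply: (has_mean_dominated (C := C)) => // t; exact: GC.
have [g gE] := choice gex.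
pose H : R := \sum_a `|h a|.
have hH a : `|h a| <= H by rewrite /H (bigD1 a) //= lerDl sumr_ge0.
pose eta := - s / 2; have eta0 : 0 < eta by rewrite /eta; lra.
have nex a : exists n1, forall n, (n1 <= n)%N ->
    series (fun t => mu t * G t a) n <= g a + eta.
  have /cvgrPdist_le/(_ _ eta0)[n1 _ hn] := gE a.
  exists n1 => n /hn /=; rewrite ler_norml => /andP[+ _]; lra.
have [na naE] := choice nex; pose n1 := (\max_a na a)%N.
have drift n a : (n1 <= n)%N -> exists2 l,
    has_mean mu (fun t => lin Pm (trunc (2 ^ n) t F) h a t a) l & l <= h a - eta.
  move=> n1n; set b := (2 ^ n)%N.
  exists (h a + s + (-1) * g a + series (fun t => mu t * G t a) b.+1).
    have := has_meanD (has_meanD (hE a) (has_meanZ (c := -1) (gE a)))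
      (has_mean_finite (mu := mu) (u := G^~ a) (b := b)).
    congr (has_mean _ _ _); apply/funext => t; rewrite /lin /G /trunc.
    case: ifP => _; first by ring.
    by rewrite [X in _ = _ + X]big1 ?addr0; [ring|move=> l _; rewrite big1 // => e _; rewrite mulr0].
  have nb : (na a <= b.+1)%N.
    apply: leq_trans (leq_bigmax a) _; apply: leq_trans n1n _.
    by rewrite ltnW // ltnS ltnW // /b ltn_expl.
  by have := naE a _ nb; rewrite /eta; lra.
have r_init w w' : r 0%N w = r 0%N w' by rewrite !r00.
pose D := (Num.bound (8 * C / eta)).+1.
have D0 : (0 < D)%N by [].
have CD : 8 * C <= D%:R * eta.
  rewrite -ler_pdivrMr //; have e0 : 0 <= 8 * C / eta.
    by rewrite divr_ge0 ?(ltW eta0) // mulr_ge0.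
  by apply: le_trans (ltW (archi_boundP e0)) _; rewrite ler_nat leqnSn.
have eps0 : 0 < eta / 8 by rewrite divr_gt0.
have [Z [mZ PZ hZ]] := borel_cantelli_bad mr rP r_init mtau tauP indep sP FC hH
  (ltW eta0) mut drift D0 eps0.
exists Z; split=> // w nZ; have [n0 good] := hZ w nZ.
exact: (gain_diverges tau0 eta0 D0 FC hH CD good).
Qed.

Lemma measurable_cvg0 (R : realType) (d : measure_display) (T : measurableType d)
    (u : nat -> T -> R) : (forall k, dmeas (u k)) -> (forall k w, 0 <= u k w) ->
  measurable [set w | (fun k => u k w) @ \oo --> (0 : R)].
Proof.
move=> mu u0; rewrite (_ : mkset _ = \bigcap_m \bigcup_K \bigcap_k
  [set w | (K <= k)%N ==> (u k w < m.+1%:R^-1)]); last first.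
  apply/seteqP; split=> [w /= /cvgrPdist_lt cw m _|w h].
    have /cw[K _ hK] : 0 < m.+1%:R^-1 :> R by rewrite invr_gt0.
    exists K => // k _ /=; apply/implyP => /hK /=.
    by rewrite sub0r normrN ger0_norm.
  apply/cvgrPdist_lt => e e0; pose m := Num.bound e^-1.
  have [K _ hK] := h m I; exists K => // k /= Kk.
  have := hK k I; rewrite /= Kk sub0r normrN ger0_norm //= => /lt_trans; apply.
  rewrite invf_plt ?posrE //; have ei : 0 <= e^-1 by rewrite invr_ge0 ltW.
  by apply: lt_trans (archi_boundP ei) _; rewrite ltr_nat.
apply: bigcapT_measurable => m; apply: bigcupT_measurable => K.
apply: bigcapT_measurable => k.
exact: (mu k [set y | (K <= k)%N ==> (y < m.+1%:R^-1)]).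
Qed.

Theorem theorem1 (R : realType) (d : measure_display) (T : measurableType d)
  (P : probability T R) (n m M : nat)
  (A : 'I_M -> 'M[R]_n) (B : 'I_M -> 'M[R]_(n, m))
  (Pm : 'M[R]_M) (pi : 'I_M -> R) (r0 : 'I_M) (r : nat -> T -> 'I_M)
  (mu : nat -> R) (tau : nat -> T -> nat)
  (Rt : 'M[R]_n) (L : 'I_M -> 'M[R]_(m, n)) (zeta : 'I_M -> 'I_M -> R) :
  (* Markov chain r *)
  stochastic Pm -> irreducible Pm -> aperiodic Pm -> invariant_distr Pm pi ->
  (forall k i, measurable [set w | r k w = i]) ->
  (forall w, r 0%N w = r0) ->
  (forall (k : nat) (s : nat -> 'I_M) (j : 'I_M),
     P (r_cyl r k s `&` [set w | r k.+1 w = j]) = (P (r_cyl r k s) * (Pm (s k) j)%:E)%E) ->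
  (* i.i.d. positive inter-observation times with distribution mu, finite mean *)
  (forall i k, measurable [set w | tau i w = k]) ->
  (forall i w, (0 < tau i w)%N) ->
  (forall (q : nat) (v : nat -> nat),
     P (tau_cyl tau q v) = (\prod_(i < q) mu (v i))%:E) ->
  cvg (series (fun t : nat => t%:R * mu t) @ \oo) ->
  (* independence of the observation process and the mode process *)
  (forall (k : nat) (s : nat -> 'I_M) (q : nat) (v : nat -> nat),
     P (r_cyl r k s `&` tau_cyl tau q v) = (P (r_cyl r k s) * P (tau_cyl tau q v))%E) ->
  (* LMI-type conditions *)
  sym_posdef Rt ->
  (forall i j, 0 < zeta i j) ->
  (forall i j, neg_semidef
     ((A i *m Rt + B i *m L j)^T *m invmx Rt *m (A i *m Rt + B i *m L j)
        - zeta i j *: Rt)) ->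
  (exists s : R, s < 0 /\
     series (fun t : nat => mu t * \sum_(1 <= l < t.+1) \sum_i \sum_j
                pi i * (Pm ^+ l.-1) i j * ln (zeta j i)) @ \oo --> s) ->
  let K := fun i => L i *m invmx Rt in
  let sig := sampled_mode r tau in
  (* almost sure stability *)
  (forall eps rho : R, 0 < eps -> 0 < rho ->
     exists2 delta : R, 0 < delta &
       forall x0 : 'cV[R]_n, vnorm x0 < delta ->
         (P [set w | exists k, (eps < vnorm (state A B K r sig x0 k w))%R] < rho%:E)%E) /\
  (* almost sure convergence to zero *)
  (forall x0 : 'cV[R]_n,
     P [set w | (fun k => vnorm (state A B K r sig x0 k w)) @ \oo --> (0 : R)] = 1%E).
Proof.
move=> sP iP aP ipi mr r00 rP mtau tau0 tauP mut indep pd z0 lmi neg K sig.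
pose F a c := ln (zeta c a).
have [Z [mZ PZ div]] := gain_diverges_ae (F := F) sP iP aP ipi mr r00 rP mtau
  tau0 tauP mut indep neg.
have [c c0 bound] := state_norm_bound r tau pd z0 lmi.
have mx x0 k : dmeas (state A B K r sig x0 k) by exact: dmeas_state.
have mvn x0 k : dmeas (fun w => vnorm (state A B K r sig x0 k w)).
  exact: (dmeas_comp (@vnorm R n) (mx x0 k)).
split=> [eps rho eps0 rho0|x0]; last first.
  set S := [set w | _]; have mS : measurable S.
    by apply: measurable_cvg0 => // k w; exact: vnorm_ge0.
  apply/eqP; rewrite eq_le probability_le1 //=.
  have <- : P (~` Z) = 1%E by rewrite probability_setC // PZ sube0.
  apply: le_measure; rewrite ?inE //; first exact: measurableC.
  move=> w /div dw; apply/cvgrPdist_lt => e e0.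
  pose a := c * vnorm x0 ^+ 2 + 1.
  have a0 : 0 < a by rewrite ltr_wpDl // mulr_ge0 // sqr_ge0.
  have [k0 hk] := dw (ln (e ^+ 2 / a)); exists k0 => // k /= /hk.
  have ea : 0 < e ^+ 2 / a by rewrite divr_gt0 // exprn_gt0.
  rewrite -ler_expR lnK ?posrE // => gk.
  rewrite sub0r normrN ger0_norm ?vnorm_ge0 //.
  rewrite -(ltr_pXn2r (n := 2)) ?nnegrE ?vnorm_ge0 ?ltW //.
  apply: le_lt_trans (bound x0 k w) _.
  rewrite -/F mulrAC; apply: (@le_lt_trans _ _ (c * vnorm x0 ^+ 2 * (e ^+ 2 / a))).
    by rewrite ler_wpM2l // mulr_ge0 // sqr_ge0.
  rewrite mulrA ltr_pdivrMr // mulrC ltr_pM2l ?exprn_gt0 //.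
  by rewrite /a ltrDl.
pose U (y : nat) := [set w | exists k, y%:R < gain r tau F k w].
have mU y : measurable (U y).
  apply: measurable_bigcup_count => k.
  exact: (dmeas_gain mr mtau F k [set g | y%:R < g]).
have PU : P (\bigcap_y U y) = 0%E.
  apply/eqP; rewrite eq_le measure_ge0 andbT -PZ le_measure ?inE //.
    exact: bigcapT_measurable.
  move=> w Uw; apply: contrapT => /div/(_ 0)[k0 hk].
  pose y := Num.bound (\sum_(k < k0) `|gain r tau F k w|).
  have s0 : 0 <= \sum_(k < k0) `|gain r tau F k w| by rewrite sumr_ge0.
  have [k] := Uw y I; apply/negP; rewrite -leNgt.
  have [/hk/le_trans->//|kk0] := leqP k0 k.
  apply: le_trans (ltW (archi_boundP s0)); apply: le_trans (ler_norm _) _.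
  by rewrite (bigD1 (Ordinal kk0)) //= lerDl sumr_ge0.
have cU : P \o U @ \oo --> P (\bigcap_y U y).
  apply: nonincreasing_cvg_mu => //.
  - by rewrite (le_lt_trans (probability_le1 _ _)) // ltry.
  - exact: bigcapT_measurable.
  move=> a b ab; apply/subsetPset => w [k bk]; exists k.
  by apply: le_lt_trans bk; rewrite ler_nat.
have /fine_cvgP[_ /cvgrPdist_lt/(_ _ rho0)[y _ hy]] : P \o U @ \oo --> 0%:E.
  by rewrite PU in cU.
have Uy : (P (U y) < rho%:E)%E.
  have := hy y (leqnn y); rewrite /= sub0r normrN ger0_norm ?fine_ge0 //.
  by rewrite -lte_fin fineK // fin_num_measure.
pose Q := c * expR y%:R; have Q0 : 0 <= Q by rewrite mulr_ge0 // expR_ge0.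
have Q1 : 0 < Q + 1 by rewrite ltr_wpDl.
exists (eps / (Q + 1)) => [|x0 xd]; first by rewrite divr_gt0.
apply: le_lt_trans Uy; apply: le_measure; rewrite ?inE //.
  by apply: measurable_bigcup_count => k; exact: (mvn x0 k [set g | eps < g]).
move=> w [k ek]; exists k; rewrite ltNge; apply/negP => gk.
move: ek; apply/negP; rewrite -leNgt -(ler_pXn2r (n := 2)) ?nnegrE ?vnorm_ge0 ?(ltW eps0) //.
apply: le_trans (bound x0 k w) _; rewrite -/F.
apply: (@le_trans _ _ (Q * (eps / (Q + 1)) ^+ 2)).
  apply: ler_pM; rewrite ?sqr_ge0 ?mulr_ge0 ?expR_ge0 //.
    by rewrite ler_wpM2l // ler_expR.
  by rewrite lerXn2r ?nnegrE ?vnorm_ge0 ?divr_ge0 ?ltW.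
rewrite expr_div_n mulrCA ler_piMr ?sqr_ge0 //.
by rewrite ler_pdivrMr ?exprn_gt0 // mul1r; nra.
Qed.
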